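(* Let $\Omega\subset\mathbb{R}^n$ be an open domain and let $X$, $Y$ be $L^2$ spaces on $\Omega$ (with values in finite-dimensional Euclidean spaces). Let $G(u)=\frac{\alpha}{2}\|u\|^2$ on $X$ with $\alpha>0$, $K\in C^1(X;Y)$, and let $F^*(v)=\int_\Omega f^*(v(x))\,dx$ on $Y$ for a proper, convex, lower semicontinuous $f^*$ with $\partial f^*$ proto-differentiable. Let $\gamma\ge0$ and $F^*_\gamma(v)=F^*(v)+\frac{\gamma}{2}\|v\|^2$, and suppose that for every $(v,\eta)$ with $\eta\in\partial F^*_\gamma(v)$ there is a cone $V(v|\eta)\subset Y$ such that $$\widetilde{D[\partial F^*_\gamma]}(v|\eta)(\Delta v)=\begin{cases}\gamma\Delta v+V(v|\eta)^\circ,&\Delta v\in V(v|\eta),\\ \emptyset,&\Delta v\notin V(v|\eta).\end{cases}$$ For $\bar u\in X$ define $$H_{\gamma,\bar u}(u,v)=\begin{pmatrix}\partial G(u)+\nabla K(\bar u)^*v\\ \partial F^*_\gamma(v)-\nabla K(\bar u)u-c_{\bar u}\end{pmatrix},\qquad c_{\bar u}=K(\bar u)-\nabla K(\bar u)\bar u.$$ Suppose that $\hat q=(\hat u,\hat v)\in X\times Y$ solves $0\in H_{\gamma,\hat u}(\hat q)$. Then $w\mapsto H_{\gamma,\hat u}^{-1}(w)$ has the Aubin property at $(0|\hat q)$ if and only if $\gamma>0$ or $\bar b(\hat q|0;H_{\gamma,\hat u})>0$, where $$\bar b(\hat q|0;H_{\gamma,\hat u})=\sup_{t>0}\inf\left\{\frac{\|\alpha^{-1}\nabla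 K(\hat u)\nabla K(\hat u)^*z-\nu\|}{\|z\|}\ \middle|\ \begin{array}{l}0\ne z\in V(v'|\eta'),\ \nu\in V(v'|\eta')^\circ,\ \eta'\in\partial F^*_\gamma(v'),\\ \|v'-\hat v\|<t,\ \|\eta'-K(\hat u)\|<t\end{array}\right\}.$$
   Context: Hilbert spaces are identified with their duals; $\nabla K(u)^*$ is the adjoint of the Fréchet derivative; $\partial$ is the convex subdifferential. The polar cone of a cone $V$ is $V^\circ=\{z\mid\langle z,z'\rangle\le0\ \forall z'\in V\}$. Tangent vectors: $T(u;U)=\{z\mid \exists\,\tau^i\searrow 0,\ u^i\in U: z=\lim_i (u^i-u)/\tau^i\}$. For $S:Q\rightrightarrows W$ between Hilbert spaces, $DS(q|w)(\Delta q)=\{\Delta w\mid(\Delta q,\Delta w)\in T((q,w);\operatorname{graph}S)\}$, and $\widetilde{DS}(q|w)$ is defined by $\operatorname{graph}\widetilde{DS}(q|w)=\operatorname{conv}\operatorname{graph}[DS(q|w)]$. A set $U$ is geometrically derivable if for every $u\in U$ and $z\in T(u;U)$ there are $\varepsilon>0$ and a curve $\xi:[0,\varepsilon]\to U$ with $\xi(0)=u$ and $\lim_{t\searrow0}(\xi(t)-\xi(0))/t=z$; $S$ is proto-differentiable if $\operatorname{graph}S$ is geometrically derivable. $F^*$ is assumed proper. $R^{-1}$ has the Aubin property at $(\hat w|\hat q)$, $\hat w\in R(\hat q)$ (equivalently $R$ is metrically regular at $\hat w$ for $\hat q$), if $\operatorname{graph}R$ is locally closed at $(\hat q,\hat w)$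 and there are $\rho,\delta,\ell>0$ such that $\inf_{p:w\in R(p)}\|q-p\|\le\ell\|w-R(q)\|$ (distance to the set $R(q)$) whenever $\|q-\hat q\|\le\delta$, $\|w-\hat w\|\le\rho$. The infimum over an empty set is $+\infty$. *)

(* Defs.v *)
From HB Require Import structures.
From mathcomp Require Import all_boot all_order all_algebra.
From mathcomp Require Import all_classical all_reals all_analysis.
From mathcomp Require Import ring lra.

Set Implicit Arguments.
Unset Strict Implicit.
Unset Printing Implicit Defensive.

Import Order.TTheory GRing.Theory Num.Theory.
Import numFieldNormedType.Exports.

Local Open Scope classical_set_scope.
Local Open Scope ring_scope.

HB.mixin Record isInnerProduct (R : realType) V & GRing.Lmodule R V := {
  dot : V -> V -> R;
  dotC : forall x y, dot x y = dot y x;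
  dotDl : forall x y z, dot (x + y) z = dot x z + dot y z;
  dotZl : forall a x z, dot (a *: x) z = a * dot x z;
  dot_ge0 : forall x, 0 <= dot x x;
  dot_eq0 : forall x, dot x x = 0 -> x = 0
}.

#[short(type=innerProductType)]
HB.structure Definition InnerProduct (R : realType) :=
  {V of GRing.Lmodule R V & isInnerProduct R V}.

HB.mixin Record NormedModule_isPreHilbert (R : realType) V
    & NormedModule R V & InnerProduct R V := {
  norm_dot : forall x : V, `|x| = Num.sqrt (dot x x)
}.

#[short(type=preHilbertType)]
HB.structure Definition PreHilbert (R : realType) :=
  {V of NormedModule R V & InnerProduct R V & NormedModule_isPreHilbert R V}.

Section inner_product_norm.
Context {R : realType} {V : innerProductType R}.
Implicit Types x y : V.

Definition dot_norm x : R := Num.sqrt (dot x x).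

Lemma cauchy_schwarz x y : dot x y ^+ 2 <= dot x x * dot y y.
Proof.
have H t : 0 <= dot x x + t * dot x y *+ 2 + t ^+ 2 * dot y y.
  have := dot_ge0 (x + t *: y).
  rewrite dotDl dotZl (dotC x) (dotC y) !dotDl !dotZl (dotC y x).
  by congr (_ <= _); ring.
have [y0|y0] := eqVneq (dot y y) 0.
  have -> : dot x y = 0 by rewrite (dot_eq0 _ y0) -(scale0r (0 : V)) dotC dotZl mul0r.
  by rewrite y0 mulr0 expr0n.
have yp : 0 < dot y y by rewrite lt_neqAle eq_sym y0 dot_ge0.
have := H (- dot x y / dot y y).
rewrite -(ler_pM2r yp) mul0r => /le_trans; rewrite -subr_ge0; apply.
by rewrite le_eqVlt; apply/orP; left; apply/eqP; field.
Qed.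

Lemma dot_normD x y : dot_norm (x + y) <= dot_norm x + dot_norm y.
Proof.
rewrite -(@ler_pXn2r _ 2) ?nnegrE ?addr_ge0 ?sqrtr_ge0//.
rewrite sqrrD !sqr_sqrtr ?dot_ge0// dotDl (dotC x) (dotC y) !dotDl (dotC y x).
have : dot x y <= dot_norm x * dot_norm y.
  rewrite /dot_norm -sqrtrM ?dot_ge0//; apply: (le_trans (ler_norm _)).
  by rewrite -sqrtr_sqr ler_wsqrtr// cauchy_schwarz.
by lra.
Qed.

Lemma dot_normZ a x : dot_norm (a *: x) = `|a| * dot_norm x.
Proof.
rewrite /dot_norm dotZl dotC dotZl mulrA -expr2 sqrtrM ?sqr_ge0//.
by rewrite sqrtr_sqr.
Qed.

Lemma dot_norm_eq0 x : dot_norm x = 0 -> x = 0.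
Proof.
move=> /eqP; rewrite sqrtr_eq0 => x0; apply: dot_eq0.
by apply/eqP; rewrite eq_le x0 dot_ge0.
Qed.

End inner_product_norm.

(* Euclidean inner product. The norm and the topology that the library puts on
   'rV[R]_m are those of the sup norm, so 'rV[R]_m is not a preHilbertType. *)
Section row_inner_product.
Context {R : realType} {m : nat}.
Implicit Types x y : 'rV[R]_m.

Definition row_dot x y : R := \sum_(i < m) x 0 i * y 0 i.

Let row_dotC x y : row_dot x y = row_dot y x.
Proof. by apply: eq_bigr => i _; rewrite mulrC. Qed.

Let row_dotDl x y z : row_dot (x + y) z = row_dot x z + row_dot y z.
Proof. by rewrite -big_split; apply: eq_bigr => i _; rewrite mxE mulrDl. Qed.

Let row_dotZl a x z : row_dot (a *: x) z = a * row_dot x z.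
Proof. by rewrite mulr_sumr; apply: eq_bigr => i _; rewrite mxE mulrA. Qed.

Let row_dot_ge0 x : 0 <= row_dot x x.
Proof. by apply: sumr_ge0 => i _; rewrite -expr2 sqr_ge0. Qed.

Let row_dot_eq0 x : row_dot x x = 0 -> x = 0.
Proof.
move=> /eqP; rewrite psumr_eq0 => [/allP x0|i _]; last by rewrite -expr2 sqr_ge0.
apply/rowP => i; rewrite mxE; apply/eqP.
by have := x0 i (mem_index_enum _); rewrite -expr2 sqrf_eq0.
Qed.

HB.instance Definition _ := isInnerProduct.Build R 'rV[R]_m
  row_dotC row_dotDl row_dotZl row_dot_ge0 row_dot_eq0.

End row_inner_product.

(* Alias of X * Y that carries the Hilbert norm instead of the max norm. *)
Definition hilbert_prod (R : realType) (X Y : preHilbertType R) : Type :=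
  (X * Y)%type.

Section hilbert_prod.
Context {R : realType} {X Y : preHilbertType R}.
Local Notation XY := (hilbert_prod X Y).
HB.instance Definition _ := GRing.Lmodule.copy XY (X * Y)%type.

Definition prod_dot (p q : XY) : R := dot p.1 q.1 + dot p.2 q.2.

Let prod_dotC p q : prod_dot p q = prod_dot q p.
Proof. by rewrite /prod_dot dotC (dotC p.2). Qed.

Let prod_dotDl p q r : prod_dot (p + q) r = prod_dot p r + prod_dot q r.
Proof. by rewrite /prod_dot !dotDl addrACA. Qed.

Let prod_dotZl a p r : prod_dot (a *: p) r = a * prod_dot p r.
Proof. by rewrite /prod_dot !dotZl mulrDr. Qed.

Let prod_dot_ge0 p : 0 <= prod_dot p p.
Proof. by rewrite addr_ge0 ?dot_ge0. Qed.

Let prod_dot_eq0 p : prod_dot p p = 0 -> p = 0.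
Proof.
move=> /eqP; rewrite paddr_eq0 ?dot_ge0// => /andP[/eqP/dot_eq0 p1 /eqP/dot_eq0 p2].
by case: p p1 p2 => p1 p2 /= -> ->.
Qed.

HB.instance Definition _ := isInnerProduct.Build R XY
  prod_dotC prod_dotDl prod_dotZl prod_dot_ge0 prod_dot_eq0.
HB.instance Definition _ := Lmodule_isNormed.Build R XY
  (@dot_normD R XY) (@dot_normZ R XY) (@dot_norm_eq0 R XY).
HB.instance Definition _ := NormedModule_isPreHilbert.Build R XY (fun=> erefl).

End hilbert_prod.

Fact row_display : measure_display.
Proof. exact: default_measure_display. Qed.

(* The sigma-algebra generated by the coordinates, which is the Borel one
   (open_measurable_row). *)
Section row_measurable.
Context {R : realType} {n : nat}.

Let coord (i : 'I_n) (x : 'rV[R]_n) : R := x 0 i.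

Let row_set0 : g_sigma_preimage coord set0.
Proof. exact: sigma_algebra0. Qed.

Let row_setC A : g_sigma_preimage coord A -> g_sigma_preimage coord (~` A).
Proof. exact: sigma_algebraC. Qed.

Let row_bigcup (F : _^nat) : (forall i, g_sigma_preimage coord (F i)) ->
  g_sigma_preimage coord (\bigcup_i (F i)).
Proof. exact: sigma_algebra_bigcup. Qed.

HB.instance Definition _ := @isMeasurable.Build row_display
  'rV[R]_n (g_sigma_preimage coord) row_set0 row_setC row_bigcup.

Lemma measurable_coord (i : 'I_n) :
  measurable_fun [set: 'rV[R]_n] (fun x : 'rV[R]_n => x 0 i).
Proof.
move=> _ Y mY; rewrite setTI; apply: sub_sigma_algebra => /=.
rewrite -bigcup_seq/=; exists i => /=; first by rewrite mem_index_enum.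
by exists Y => //; rewrite setTI.
Qed.

Lemma measurable_fun_row d (T : measurableType d) (f : T -> 'rV[R]_n) :
  (forall i, measurable_fun [set: T] (fun x => f x 0 i)) ->
  measurable_fun [set: T] f.
Proof.
move=> mf _ A mA; rewrite setTI.
suff : g_sigma_preimage (fun i x => f x 0 i) `<=` measurable.
  apply; rewrite (_ : (fun i x => f x 0 i) = (fun i => coord i \o f))//.
  by rewrite g_sigma_preimage_comp; exists A => //; rewrite setTI.
apply: smallest_sub; first exact: sigma_algebra_measurable.
move=> B; rewrite -bigcup_seq => -[i _] [C mC <-]; exact: mf.
Qed.

Lemma open_measurable_row (U : set 'rV[R]_n) : open U -> measurable U.
Proof.
move=> oU.
pose Q (qk : 'rV[rat]_n * nat) : set 'rV[R]_n :=
  [set x | forall i, `|ratr (qk.1 0 i) - x 0 i| < qk.2.+1%:R^-1].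
have mQ qk : measurable (Q qk).
  rewrite (_ : Q qk = \bigcap_(i in [set: 'I_n])
    ((fun x : 'rV[R]_n => x 0 i) @^-1` ball (ratr (qk.1 0 i) : R) qk.2.+1%:R^-1)).
    apply: fin_bigcap_measurable => [|i _]; first exact: finite_finset.
    rewrite -[X in measurable X]setTI; apply: measurable_coord => //.
    by rewrite (ball_itv (ratr (qk.1 0 i) : R)); exact: measurable_itv.
  by apply/seteqP; split => x /= h i => [_|]; exact: h.
rewrite (_ : U = \bigcup_(qk in [set qk | Q qk `<=` U]) Q qk).
  rewrite bigcup_mkcond; apply: countable_bigcupT_measurable => // qk.
  by case: ifP.
apply/seteqP; split => [x Ux|x [qk + Qx]]; last exact.
have /nbhs_ballP[e /= e0 xe] : nbhs x U by exact: open_nbhs_nbhs.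
have [k ke] : exists k : nat, k.+1%:R^-1 < e / 2.
  have [k _ hk] := near_infty_natSinv_lt (PosNum (divr_gt0 e0 (ltr0n R 2))).
  by exists k; apply: hk => /=.
have Hq i : exists q : rat, `|ratr q - x 0 i| < (k.+1%:R^-1 : R).
  have k0 : 0 < k.+1%:R^-1 :> R by rewrite invr_gt0 ltr0n.
  have xk : x 0 i - k.+1%:R^-1 < x 0 i + k.+1%:R^-1.
    by rewrite ltrBlDr -addrA ltrDl addr_gt0.
  have [q] := rat_in_itvoo xk.
  rewrite in_itv/= => /andP[q1 q2]; exists q.
  by rewrite ltr_norml ltrBrDl q1 ltrBlDl q2.
have [q hq] := choice Hq.
exists (\row_i q i, k); last by move=> i /=; rewrite mxE; exact: hq.
move=> y /= Qy; apply: xe; split => // i j; rewrite (ord1 i){i}.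
have := Qy j; rewrite /= mxE => yq; rewrite /ball /=.
rewrite (_ : x 0 j - y 0 j = (x 0 j - ratr (q j)) + (ratr (q j) - y 0 j)); last ring.
apply: (le_lt_trans (ler_normD _ _)); rewrite [`|x 0 j - _|]distrC.
by rewrite (splitr e) ltrD// (lt_trans _ ke)// hq.
Qed.

End row_measurable.

Section lebesgue_row.
Context (R : realType).

Definition consrow n (p : measurableTypeR R * 'rV[R]_n) : 'rV[R]_n.+1 :=
  row_mx (p.1 : R)%:M p.2.

Lemma consrow0 n (p : measurableTypeR R * 'rV[R]_n) : consrow p 0 0 = p.1.
Proof.
rewrite /consrow (_ : 0 = lshift n (0 : 'I_1)); last exact/val_inj.
by rewrite (@row_mxEl _ 1 1 n) mxE eqxx mulr1n.
Qed.

Lemma consrowS n (p : measurableTypeR R * 'rV[R]_n) j :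
  consrow p 0 (lift ord0 j) = p.2 0 j.
Proof.
rewrite /consrow (_ : lift ord0 j = rshift 1 j); last exact/val_inj.
by rewrite (@row_mxEr _ 1 1 n).
Qed.

Lemma measurable_consrow n : measurable_fun setT (@consrow n).
Proof.
apply: measurable_fun_row => i; case: (unliftP ord0 i) => [j|] ->.
  under eq_fun do rewrite consrowS.
  by apply: (measurableT_comp (measurable_coord j)); exact: measurable_snd.
under eq_fun do rewrite consrow0.
exact: measurable_fst.
Qed.

Section step.
Context (n : nat) (mu : {sigma_finite_measure set 'rV[R]_n -> \bar R}).

Definition lebesgue_step : set 'rV[R]_n.+1 -> \bar R :=
  pushforward (lebesgue_measure \x mu)%E (@consrow n).

HB.instance Definition _ := Measure.copy lebesgue_step
  (measure_function_pushforward__canonical__measure_function_Measure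
    (lebesgue_measure \x mu)%E (@measurable_consrow n)).

Let lebesgue_step_sigma_finite : sigma_finite setT lebesgue_step.
Proof.
have /sigma_finiteP[F [TF ndF Foo]] := sigma_finiteT (@lebesgue_measure R).
have /sigma_finiteP[G [TG ndG Goo]] := sigma_finiteT mu.
pose hd (x : 'rV[R]_n.+1) : measurableTypeR R := x 0 0.
pose tl (x : 'rV[R]_n.+1) : 'rV[R]_n := \row_j x 0 (lift ord0 j).
have mhd : measurable_fun setT hd by exact: measurable_coord.
have mtl : measurable_fun setT tl.
  apply: measurable_fun_row => i; under eq_fun do rewrite mxE.
  exact: measurable_coord.
have hdE p : hd (consrow p) = p.1 by rewrite /hd consrow0.
have tlE p : tl (consrow p) = p.2.
  by apply/rowP => j; rewrite /tl mxE consrowS.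
exists (fun k => hd @^-1` F k `&` tl @^-1` G k).
  apply/esym; rewrite predeqE => x; split => // _.
  have [k _ Fk] : (\bigcup_k F k) (hd x) by rewrite -TF.
  have [l _ Gl] : (\bigcup_k G k) (tl x) by rewrite -TG.
  exists (maxn k l) => //; split => /=.
  - by move: (hd x) Fk; exact/subsetPset/ndF/leq_maxl.
  - by move: (tl x) Gl; exact/subsetPset/ndG/leq_maxr.
move=> k; have [mF Fk] := Foo k; have [mG Gk] := Goo k.
split.
  by apply: measurableI; rewrite -[X in measurable X]setTI; [exact: mhd|exact: mtl].
rewrite /lebesgue_step /pushforward.
rewrite (_ : _ @^-1` _ = F k `*` G k); last first.
  by apply/seteqP; split => p /=; rewrite hdE tlE.
by rewrite product_measure1E// lte_mul_pinfty// ge0_fin_numE.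
Qed.

HB.instance Definition _ :=
  Measure_isSigmaFinite.Build _ _ _ lebesgue_step lebesgue_step_sigma_finite.

End step.

(* Lebesgue measure on R^n, as an iterated product; lebesgue_row_box below gives
   its value on boxes. *)
Fixpoint lebesgue_row n : {sigma_finite_measure set 'rV[R]_n -> \bar R} :=
  if n is n'.+1 then lebesgue_step (lebesgue_row n') else \d_(0 : 'rV[R]_0).

Lemma lebesgue_row_box n (a b : 'rV[R]_n) : (forall i, a 0 i <= b 0 i) ->
  lebesgue_row n [set x : 'rV[R]_n | forall i, a 0 i < x 0 i <= b 0 i] =
  (\prod_(i < n) (b 0 i - a 0 i))%:E.
Proof.
elim: n => [|n IHn] in a b *.
  by move=> _; rewrite big_ord0 /= diracE mem_set// => -[].
move=> ab; pose tl (x : 'rV[R]_n.+1) : 'rV[R]_n := \row_j x 0 (lift ord0 j).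
have mbox : measurable [set x : 'rV[R]_n | forall i, tl a 0 i < x 0 i <= tl b 0 i].
  rewrite (_ : mkset _ = \bigcap_(i in [set: 'I_n])
    ((fun x : 'rV[R]_n => x 0 i) @^-1` `]tl a 0 i, tl b 0 i]%classic)).
    apply: fin_bigcap_measurable => [|i _]; first exact: finite_finset.
    rewrite -[X in measurable X]setTI.
    exact: (measurable_coord i measurableT (measurable_itv `]tl a 0 i, tl b 0 i])).
  apply/seteqP; split => x /= h i; last by have := h i I; rewrite /= in_itv.
  by move=> _; rewrite /= in_itv; exact: h.
transitivity ((lebesgue_measure \x lebesgue_row n)%E
    (`]a 0 0, b 0 0] `*` [set x : 'rV[R]_n | forall i, tl a 0 i < x 0 i <= tl b 0 i])).
  congr (product_measure1 _ _ _); apply/seteqP; split => p /=.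
    rewrite in_itv/= => H; split; first by have := H 0; rewrite consrow0.
    by move=> j; have := H (lift ord0 j); rewrite consrowS !mxE.
  rewrite in_itv/= => -[H0 H] i; case: (unliftP ord0 i) => [j|] ->.
    by have := H j; rewrite consrowS !mxE.
  by rewrite consrow0.
etransitivity; first exact: (product_measure1E lebesgue_measure
  (lebesgue_row n) (measurable_itv `]a 0 0, b 0 0]) mbox).
rewrite IHn => [|i]; last by rewrite !mxE.
rewrite big_ord_recl EFinM; congr (_ * _)%E.
  apply: (eq_trans (lebesgue_measure_itv `]a 0 0, b 0 0])) => /=.
  rewrite lte_fin; have := ab 0; rewrite le_eqVlt => /predU1P[<-|->]; last by [].
  by rewrite ltxx subrr.
by congr _%:E; apply: eq_bigr => i _; rewrite !mxE.
Qed.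

(* Lebesgue measure of the subset Omega, carried by all of R^n: functions that
   agree almost everywhere on Omega are identified, whatever their values
   outside. *)
Definition lebesgue_on n (Omega : set 'rV[R]_n) (oO : open Omega) :
  {measure set 'rV[R]_n -> \bar R} :=
  mrestr (lebesgue_row n) (open_measurable_row oO).

End lebesgue_row.

Section L2fun.
Context d (T : measurableType d) (R : realType).
Variables (mu : {measure set T -> \bar R}) (m : nat).

Definition l2fun : {pred (T -> 'rV[R]_m)} :=
  [pred f : T -> 'rV[R]_m |
    [forall i : 'I_m, (fun x => f x 0 i) \in Lfun mu 2%:E]].

Lemma l2funP (f : T -> 'rV[R]_m) :
  reflect (forall i, (fun x => f x 0 i) \in Lfun mu 2%:E) (f \in l2fun).
Proof. exact: forallP. Qed.

Let l2fun_submod_closed : submod_closed l2fun.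
Proof.
have [L0 Llin] := Lfun_submod_closed mu (lee1n 2).
split=> [|a f g /l2funP fl /l2funP gl]; apply/l2funP => i.
  by rewrite (_ : (fun x => _) = 0)//; apply/funext => x; rewrite mxE.
rewrite (_ : (fun x => _) = a *: (fun x => f x 0 i) + (fun x => g x 0 i)).
  exact: Llin.
by apply/funext => x; rewrite !mxE.
Qed.

HB.instance Definition _ :=
  GRing.isSubmodClosed.Build _ _ l2fun l2fun_submod_closed.

Record L2fun := MkL2fun { L2fun_val :> T -> 'rV[R]_m; _ : L2fun_val \in l2fun }.

HB.instance Definition _ := [isSub for L2fun_val].
HB.instance Definition _ := [Choice of L2fun by <:].
HB.instance Definition _ := [SubChoice_isSubLmodule of L2fun by <:].

Definition L2_eq (f g : L2fun) := `[< ae_eq mu setT f g >].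

Let L2_eq_refl : reflexive L2_eq.
Proof. by move=> f; apply/asboolP; exact: ae_eq_refl. Qed.

Let L2_eq_sym : symmetric L2_eq.
Proof. by move=> f g; apply/asboolP/asboolP => /ae_eq_sym. Qed.

Let L2_eq_trans : transitive L2_eq.
Proof.
by move=> g f h /asboolP fg /asboolP gh; apply/asboolP; exact: ae_eq_trans gh.
Qed.

Canonical L2_equiv := EquivRel L2_eq L2_eq_refl L2_eq_sym L2_eq_trans.

Local Open Scope quotient_scope.

(* L^2(mu; R^m): square-integrable measurable functions modulo almost-everywhere
   equality. *)
Definition L2 : Type := {eq_quot L2_eq}.
HB.instance Definition _ := Choice.on L2.
HB.instance Definition _ := EqQuotient.on L2.

Definition L2_fun (f : L2) : T -> 'rV[R]_m := repr f.
Coercion L2_fun : L2 >-> Funclass.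

Lemma L2_eqP (f g : L2fun) : ae_eq mu setT f g <-> \pi_L2 f = \pi_L2 g.
Proof.
split=> [fg|/eqmodP/asboolP//]; first by apply/eqmodP/asboolP.
Qed.

Lemma L2_reprK (f : L2fun) : ae_eq mu setT (repr (\pi_L2 f)) f.
Proof. by apply/L2_eqP; rewrite reprK. Qed.

Definition L2_zero : L2 := \pi_L2 0.
Definition L2_opp (f : L2) : L2 := \pi_L2 (- repr f).
Definition L2_add (f g : L2) : L2 := \pi_L2 (repr f + repr g).
Definition L2_scale (a : R) (f : L2) : L2 := \pi_L2 (a *: repr f).

Let addE (f g : L2fun) : L2_add (\pi_L2 f) (\pi_L2 g) = \pi_L2 (f + g).
Proof.
apply/L2_eqP; have := L2_reprK f; have := L2_reprK g.
by apply: filterS2 => x + + _ => /(_ I) gx /(_ I) fx; rewrite /= fctE gx fx.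
Qed.

Let oppE (f : L2fun) : L2_opp (\pi_L2 f) = \pi_L2 (- f).
Proof.
apply/L2_eqP; have := L2_reprK f.
by apply: filterS => x + _ => /(_ I) fx; rewrite /= !fctE fx.
Qed.

Let scaleE a (f : L2fun) : L2_scale a (\pi_L2 f) = \pi_L2 (a *: f).
Proof.
apply/L2_eqP; have := L2_reprK f.
by apply: filterS => x + _ => /(_ I) fx; rewrite /= !fctE fx.
Qed.

Let L2_addA : associative L2_add.
Proof.
elim/quotW => f; elim/quotW => g; elim/quotW => h.
by rewrite (addE g h) (addE f (g + h)) (addE f g) (addE (f + g) h) addrA.
Qed.

Let L2_addC : commutative L2_add.
Proof. by elim/quotW => f; elim/quotW => g; rewrite (addE f g) (addE g f) addrC. Qed.

Let L2_add0 : left_id L2_zero L2_add.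
Proof. by elim/quotW => f; rewrite (addE 0 f) add0r. Qed.

Let L2_addN : left_inverse L2_zero L2_opp L2_add.
Proof. by elim/quotW => f; rewrite (oppE f) (addE (- f) f) addNr. Qed.

HB.instance Definition _ :=
  GRing.isZmodule.Build L2 L2_addA L2_addC L2_add0 L2_addN.

Let L2_scaleA a b (f : L2) : L2_scale a (L2_scale b f) = L2_scale (a * b) f.
Proof.
elim/quotW: f => f.
by rewrite (scaleE b f) (scaleE a (b *: f)) (scaleE (a * b) f) scalerA.
Qed.

Let L2_scale1 : left_id 1 L2_scale.
Proof. by elim/quotW => f; rewrite scaleE scale1r. Qed.

Let L2_scaleDr : right_distributive L2_scale +%R.
Proof.
move=> a; elim/quotW => f; elim/quotW => g.
rewrite (scaleE a f) (scaleE a g) [LHS](_ : _ = L2_scale a (\pi_L2 (f + g))).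
  by rewrite (scaleE a (f + g)) scalerDr; exact/esym/addE.
by congr L2_scale; exact: addE.
Qed.

Let L2_scaleDl (f : L2) : {morph L2_scale^~ f : a b / a + b}.
Proof.
elim/quotW: f => f a b; rewrite (scaleE a f) (scaleE b f) (scaleE (a + b) f).
by rewrite scalerDl; exact/esym/addE.
Qed.

HB.instance Definition _ := GRing.Zmodule_isLmodule.Build R L2
  L2_scaleA L2_scale1 L2_scaleDr L2_scaleDl.

Lemma L2_fun0 : ae_eq mu setT (0 : L2) (cst 0).
Proof. exact: (L2_reprK 0). Qed.

Lemma L2_funD (f g : L2) : ae_eq mu setT (f + g : L2) (fun x => f x + g x).
Proof. exact: L2_reprK. Qed.

Lemma L2_funZ a (f : L2) : ae_eq mu setT (a *: f : L2) (fun x => a *: f x).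
Proof. exact: L2_reprK. Qed.

Lemma L2_ext (f g : L2) : ae_eq mu setT f g -> f = g.
Proof. by move=> /L2_eqP; rewrite !reprK. Qed.

Lemma L2_coord (f : L2) i : (fun x => f x 0 i) \in Lfun mu 2%:E.
Proof. by move: i; apply/l2funP; exact: (valP (repr f)). Qed.

Definition L2_dot (f g : L2) : R := (\int[mu]_x dot (f x) (g x))%R.

Lemma L2_dot_integrable (f g : L2) :
  mu.-integrable setT (EFin \o (fun x => dot (f x) (g x))).
Proof.
rewrite (_ : _ \o _ = fun x => (\sum_(i < m) (f x 0 i * g x 0 i)%:E)%E).
  apply: integrable_sum => // i _.
  have := Lfun2_mul_Lfun1 (L2_coord f i) (L2_coord g i).
  by move=> /Lfun1_integrable.
by apply/funext => x; rewrite /= sumEFin.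
Qed.

Lemma ae_eq_L2_dot (f g h k : T -> 'rV[R]_m) :
  ae_eq mu setT f h -> ae_eq mu setT g k ->
  mu.-integrable setT (EFin \o (fun x => dot (f x) (g x))) ->
  mu.-integrable setT (EFin \o (fun x => dot (h x) (k x))) ->
  (\int[mu]_x dot (f x) (g x) = \int[mu]_x dot (h x) (k x))%R.
Proof.
move=> fh gk /measurable_int mfg /measurable_int mhk.
rewrite /Rintegral; congr fine; apply: ae_eq_integral => //.
by move: fh gk; apply: filterS2 => x + + _ => /(_ I) /= -> /(_ I) ->.
Qed.

Let L2_dotC (f g : L2) : L2_dot f g = L2_dot g f.
Proof. by congr fine; apply: eq_integral => x _; rewrite dotC. Qed.

Let L2_dotDl (f g h : L2) : L2_dot (f + g) h = L2_dot f h + L2_dot g h.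
Proof.
rewrite /L2_dot -RintegralD//; try exact: L2_dot_integrable.
under [RHS]eq_Rintegral do rewrite -dotDl.
apply: (ae_eq_L2_dot (L2_funD f g) (ae_eq_refl _ _ _)).
  exact: L2_dot_integrable.
rewrite (_ : _ \o _ = (fun x => (dot (f x) (h x))%:E) \+
  (fun x => (dot (g x) (h x))%:E))%E; last by apply/funext => x /=; rewrite dotDl.
exact: (integrableD measurableT (L2_dot_integrable f h) (L2_dot_integrable g h)).
Qed.

Let L2_dotZl a (f h : L2) : L2_dot (a *: f) h = a * L2_dot f h.
Proof.
rewrite /L2_dot -RintegralZl//; last exact: L2_dot_integrable.
under [RHS]eq_Rintegral do rewrite -dotZl.
apply: (ae_eq_L2_dot (L2_funZ a f) (ae_eq_refl _ _ _)).
  exact: L2_dot_integrable.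
rewrite (_ : _ \o _ = (fun x => a%:E * (dot (f x) (h x))%:E)%E).
  exact: (integrableZl measurableT a (L2_dot_integrable f h)).
by apply/funext => x /=; rewrite dotZl.
Qed.

Let L2_dot_ge0 (f : L2) : 0 <= L2_dot f f.
Proof. by apply: Rintegral_ge0 => x _; exact: dot_ge0. Qed.

Let L2_dot_eq0 (f : L2) : L2_dot f f = 0 -> f = 0.
Proof.
have ff := L2_dot_integrable f f.
move=> f0; apply: L2_ext.
apply: (ae_eq_trans _ (ae_eq_sym L2_fun0)).
have : ae_eq mu setT (EFin \o (fun x => dot (f x) (f x))) (cst 0%E).
  apply/(ae_eq_integral_abs _ measurableT (measurable_int _ ff)).
  under eq_integral => x _ do rewrite /= ger0_norm ?dot_ge0//.
  rewrite -[LHS]fineK; last exact: integrable_fin_num.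
  by move: f0; rewrite /L2_dot /Rintegral => ->.
by apply: filterS => x /(_ I) /= [/dot_eq0 ->].
Qed.

HB.instance Definition _ := isInnerProduct.Build R L2
  L2_dotC L2_dotDl L2_dotZl L2_dot_ge0 L2_dot_eq0.
HB.instance Definition _ := Lmodule_isNormed.Build R L2
  (@dot_normD R L2) (@dot_normZ R L2) (@dot_norm_eq0 R L2).
HB.instance Definition _ := NormedModule_isPreHilbert.Build R L2 (fun=> erefl).

End L2fun.

Definition domain (R : realType) n (Omega : set 'rV[R]_n) :=
  connected Omega /\ Omega !=set0.

Notation L2_on oOmega m := (L2 (lebesgue_on oOmega) m).

Section variational_analysis.
Context {R : realType}.

Definition tangent (V : normedModType R) (U : set V) (u : V) : set V :=
  [set z | exists tau : nat -> R, exists ui : nat -> V,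
    [/\ forall i, 0 < tau i, tau @ \oo --> 0, forall i, U (ui i)
      & (fun i => (tau i)^-1 *: (ui i - u)) @ \oo --> z]].

Definition graph (Q W : Type) (S : Q -> set W) : set (Q * W) :=
  [set p | S p.1 p.2].

Definition inverse (Q W : Type) (S : Q -> set W) : W -> set Q :=
  fun w => [set q | S q w].

Definition graph_deriv (Q W : normedModType R) (S : Q -> set W)
    (q : Q) (w : W) : Q -> set W :=
  fun dq => [set dw | tangent (graph S) (q, w) (dq, dw)].

Definition conv_hull (E : lmodType R) (A : set E) : set E :=
  smallest (@convex_set R E) A.

Definition conv_graph_deriv (Q W : normedModType R) (S : Q -> set W)
    (q : Q) (w : W) : Q -> set W :=
  fun dq => [set dw | conv_hull (graph (graph_deriv S q w)) (dq, dw)].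

Definition geometrically_derivable (V : normedModType R) (U : set V) :=
  forall u z, U u -> tangent U u z ->
    exists eps : R, exists xi : R -> V,
      [/\ 0 < eps, forall t, 0 <= t <= eps -> U (xi t), xi 0 = u
        & t^-1 *: (xi t - xi 0) @[t --> 0^'+] --> z].

Definition proto_differentiable (Q W : normedModType R) (S : Q -> set W) :=
  geometrically_derivable (graph S).

Definition cone (V : lmodType R) (C : set V) :=
  forall t z, 0 < t -> C z -> C (t *: z).

Definition polar (V : innerProductType R) (C : set V) : set V :=
  [set z | forall z', C z' -> dot z z' <= 0].

Definition proper_fun (T : Type) (f : T -> \bar R) :=
  (forall x, f x != -oo%E) /\ (exists x, f x != +oo%E).

Definition econvex (V : lmodType R) (f : V -> \bar R) :=
  forall (x y : V) (t : R), 0 <= t <= 1 ->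
    (f (t *: x + (1 - t) *: y)%R <= t%:E * f x + (1 - t)%:E * f y)%E.

(* No subgradients where f is infinite. *)
Definition subdiff (V : innerProductType R) (f : V -> \bar R) (x : V) : set V :=
  [set xi | f x \is a fin_num /\
    forall y, (f x + (dot xi (y - x))%:E <= f y)%E].

Definition C1 (X Y : normedModType R) (K : X -> Y) :=
  (forall u, differentiable K u) /\
  (forall u (e : R), 0 < e -> \forall u' \near u,
    forall h, `|'d K u' h - 'd K u h| <= e * `|h|).

(* The adjoint is unique if it exists, and it exists for every bounded linear
   map on a complete space; the value is 0 when there is none. *)
Definition adjoint (X Y : innerProductType R) (A : X -> Y) : Y -> X :=
  xget (fun=> 0) [set B | forall x y, dot (A x) y = dot x (B y)].

Definition locally_closed (E : topologicalType) (A : set E) (x : E) :=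
  exists N, [/\ nbhs x N, closed N & closed (A `&` N)].

(* The infimum over the empty set is +oo. *)
Definition dist_set (V : normedModType R) (x : V) (A : set V) : \bar R :=
  ereal_inf [set (`|x - a|)%:E | a in A].

(* Aubin property of S = T^-1 at what for qhat, as metric regularity of T at
   qhat for what. *)
Definition aubin (W Q : normedModType R) (S : W -> set Q)
    (what : W) (qhat : Q) :=
  let T := inverse S in
  [/\ T qhat what, locally_closed (graph T) (qhat, what)
    & exists rho delta l : R, [/\ 0 < rho, 0 < delta, 0 < l
      & forall q w, `|q - qhat| <= delta -> `|w - what| <= rho ->
        (dist_set q (S w) <= l%:E * dist_set w (T q))%E]].

End variational_analysis.

Section saddle_point.
Context {R : realType}.

Definition quadratic (X : normedModType R) (a : R) (u : X) : \bar R :=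
  (a / 2 * `|u| ^+ 2)%:E.

(* The library's integral is the difference of the integrals of the positive and
   negative parts with +oo - oo = -oo; on a functional that is required to be
   proper this agrees with the convention +oo - oo = +oo. *)
Definition integral_functional d (T : measurableType d)
    (mu : {measure set T -> \bar R}) m (f : 'rV[R]_m -> \bar R)
    (v : L2 mu m) : \bar R :=
  (\int[mu]_x f (v x))%E.

Definition regularized (Y : normedModType R) (F : Y -> \bar R) (gamma : R)
    (v : Y) : \bar R :=
  (F v + quadratic gamma v)%E.

Context {X Y : preHilbertType R}.

Definition saddle_map (G : X -> \bar R) (F : Y -> \bar R) (K : X -> Y)
    (ubar : X) (q : hilbert_prod X Y) : set (hilbert_prod X Y) :=
  let: (u, v) := q in
  let c := K ubar - 'd K ubar ubar in
  [set w | (exists2 xi, subdiff G u xi & w.1 = xi + adjoint ('d K ubar) v) /\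
           (exists2 eta, subdiff F v eta & w.2 = eta - 'd K ubar u - c)].

Definition bbar (alpha : R) (F : Y -> \bar R) (K : X -> Y)
    (V : Y -> Y -> set Y) (uhat : X) (vhat : Y) : \bar R :=
  let A : X -> Y := 'd K uhat in
  ereal_sup [set ereal_inf
    [set (`|alpha^-1 *: A (adjoint A p.1) - p.2| / `|p.1|)%:E | p in
      [set p : Y * Y | p.1 != 0 /\ exists v' eta',
        [/\ V v' eta' p.1, polar (V v' eta') p.2, subdiff F v' eta',
            `|v' - vhat| < t & `|eta' - K uhat| < t]]]
    | t in [set t : R | 0 < t]].

End saddle_point.

(* Main.v *)
From HB Require Import structures.
Require Import Defs.
From mathcomp Require Import all_boot all_order all_algebra.
From mathcomp Require Import all_classical all_reals all_analysis.
From mathcomp Require Import measurable_realfun.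
From mathcomp Require Import ring lra.

Set Implicit Arguments.
Unset Strict Implicit.
Unset Printing Implicit Defensive.

Import Order.TTheory GRing.Theory Num.Theory.
Import numFieldNormedType.Exports.

Local Open Scope classical_set_scope.
Local Open Scope ring_scope.

(* Write A for the derivative of K at uhat and B = alpha^-1 A A^*. Eliminating u
   turns the Aubin property into metric regularity of the monotone operator
   dF_gamma + B, whose graph is parametrized by s = v + eta through the
   resolvent P of dF_gamma: v = P s, eta = s - P s.
   P acts pointwise as a proximal map of the integrand f, and proto-
   differentiability of df makes it directionally differentiable. The assumption
   on V identifies the derivative of P with the projection onto the cone V, so
   that the tangents of the graph of dF_gamma at (v, eta) are the pairs
   (z, gamma z + nu) with z in V, nu in the polar of V and <z, nu> = 0.
   Since |B z|^2 <= |B| <B z, z>, for gamma = 0 the modulus is positive if and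
   only if <B z, z> >= kappa |z|^2 on the cones V of all nearby points.
   Sufficiency: if <B z, z> + gamma |z|^2 >= kappa |z|^2 on the nearby cones, then
   |w - (s - P s + B P s)| has a direction of descent of uniform rate as long as
   it is positive, and Caristi's principle provides a zero at a distance
   proportional to the residual.
   Necessity for gamma = 0: (z, 0) is tangent for every z in V. Monotonicity
   between the corresponding curve and the solutions for the perturbations
   w + h eps z bounds <B z, z> from below. *)

(** * Inner products and limits *)

(** The hypothesis on V describes only the convexified derivative, where every z in V is paired with
    every nu in the polar cone. The orthogonality of z and nu is invisible there; it comes back from
    the cocoercivity of P, whose infinitesimal form has the sign opposite to polarity. Moving s
    along the residual r = (1 + gamma) z + nu itself may fail to reduce it, since the cross term <B
    z, nu> can outweigh the gain. Multiplying nu by a large constant leaves the projection z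
    unchanged and makes the |nu|^2 term dominate. The resulting rate depends only on gamma, |B| and
    the coercivity constant, hence is the same at all nearby s; this is what yields a Lipschitz
    estimate. On a domain of infinite measure, composing an L2 function with the pointwise proximal
    map need not give an L2 function. The given solution serves as an anchor: there the proximal map
    returns vhat, and nonexpansiveness controls the increments. In the modulus, nu = 0 gives the
    bound needed for sufficiency; for necessity, <nu, z> <= 0 shows that subtracting nu cannot spoil
    coercivity. *)

Section inner_product_theory.
Context {R : realType} {V : innerProductType R}.
Implicit Types x y z : V.

Lemma dotDr x y z : dot x (y + z) = dot x y + dot x z.
Proof. by rewrite dotC dotDl !(dotC _ x). Qed.

Lemma dotZr a x y : dot x (a *: y) = a * dot x y.
Proof. by rewrite dotC dotZl (dotC y). Qed.

Lemma dotNl x y : dot (- x) y = - dot x y.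
Proof. by rewrite -scaleN1r dotZl mulN1r. Qed.

Lemma dotNr x y : dot x (- y) = - dot x y.
Proof. by rewrite dotC dotNl dotC. Qed.

Lemma dotBl x y z : dot (x - y) z = dot x z - dot y z.
Proof. by rewrite dotDl dotNl. Qed.

Lemma dotBr x y z : dot x (y - z) = dot x y - dot x z.
Proof. by rewrite dotDr dotNr. Qed.

Lemma dot0l x : dot 0 x = 0.
Proof. by rewrite -(scale0r (0 : V)) dotZl mul0r. Qed.

Lemma dot0r x : dot x 0 = 0.
Proof. by rewrite dotC dot0l. Qed.

Lemma dot_inj x y : (forall z, dot z x = dot z y) -> x = y.
Proof.
move=> xy; apply/eqP; rewrite -subr_eq0; apply/eqP/dot_eq0.
by rewrite dotBr xy subrr.
Qed.

End inner_product_theory.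

(** Pairing both sides with an arbitrary vector turns an identity between linear combinations into a
    polynomial identity over the reals. *)
Ltac dot_ring := apply: dot_inj => ?; rewrite ?(dotDr, dotNr, dotZr, dot0r); ring.
Ltac dot_field :=
  apply: dot_inj => ?; rewrite ?(dotDr, dotNr, dotZr, dot0r); field.

Section pre_hilbert_theory.
Context {R : realType} {V : preHilbertType R}.
Implicit Types x y z : V.

Lemma normr_sqr_dot x : `|x| ^+ 2 = dot x x.
Proof. by rewrite norm_dot sqr_sqrtr// dot_ge0. Qed.

Lemma normr_dot_le x y : `|dot x y| <= `|x| * `|y|.
Proof.
rewrite -(@ler_pXn2r _ 2) ?nnegrE ?mulr_ge0//.
by rewrite real_normK ?num_real// exprMn !normr_sqr_dot cauchy_schwarz.
Qed.

Lemma dot_le x y : dot x y <= `|x| * `|y|.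
Proof. exact: le_trans (ler_norm _) (normr_dot_le x y). Qed.

Lemma dot_ge x y : - (`|x| * `|y|) <= dot x y.
Proof. by have := normr_dot_le x y; rewrite ler_norml => /andP[]. Qed.

End pre_hilbert_theory.

(** Completeness is carried as a separate hypothesis because [preHilbertType] does not include
    it. *)
Definition seq_complete (R : realType) (V : normedModType R) :=
  forall u : nat -> V,
    (forall e : R, 0 < e -> exists N : nat, forall i j, (N <= i)%N -> (N <= j)%N ->
       `|u i - u j| <= e) ->
    exists l : V, u @ \oo --> l.

Section sequences.
Context {R : realType}.

Lemma cvgn_le_cst (u : nat -> R) (l c : R) :
  u @ \oo --> l -> (\forall k \near \oo, u k <= c) -> l <= c.
Proof.
move=> ul uc; rewrite -(cvg_lim (@Rhausdorff R) ul).
by apply: limr_le => //; apply: cvgP ul.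
Qed.

Lemma cvgn_ge_cst (u : nat -> R) (l c : R) :
  u @ \oo --> l -> (\forall k \near \oo, c <= u k) -> c <= l.
Proof.
move=> ul uc; rewrite -(cvg_lim (@Rhausdorff R) ul).
by apply: limr_ge => //; apply: cvgP ul.
Qed.

Lemma near_harmonic_lt (e : R) : 0 < e -> \forall k \near \oo, k.+1%:R^-1 < e.
Proof. by move=> e0; exact: (near_infty_natSinv_lt (PosNum e0)). Qed.

Lemma cvgn_dot (V : preHilbertType R) (u v : nat -> V) (x y : V) :
  u @ \oo --> x -> v @ \oo --> y -> (fun k => dot (u k) (v k)) @ \oo --> dot x y.
Proof.
move=> ux vy; apply/subr_cvg0/norm_cvg0P.
have h : (fun k => `|u k - x| * `|v k| + `|x| * `|v k - y|) @ \oo -->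
    0 * `|y| + `|x| * 0.
  apply: cvgD; apply: cvgM.
  - by apply/norm_cvg0P/subr_cvg0.
  - exact: cvg_norm.
  - exact: cvg_cst.
  - by apply/norm_cvg0P/subr_cvg0.
rewrite mul0r mulr0 addr0 in h.
apply: (squeeze_cvgr _ (@cvg_cst _ _ _ _ _ ) h); apply: nearW => k /=.
rewrite normr_ge0 /=.
have -> : dot (u k) (v k) - dot x y = dot (u k - x) (v k) + dot x (v k - y).
  by rewrite dotBl dotBr addrA subrK.
by apply: le_trans (ler_normD _ _) _; rewrite lerD// normr_dot_le.
Qed.

End sequences.

Lemma lip_continuous (R : realType) (V W : normedModType R) (f : V -> W) (C : R) :
  (forall x y, `|f x - f y| <= C * `|x - y|) -> continuous f.
Proof.
move=> fC x; apply/subr_cvg0/norm_cvg0P.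
have h : C * `|y - x| @[y --> x] --> C * 0.
  apply: cvgM; first exact: cvg_cst.
  by apply/norm_cvg0P/subr_cvg0; exact: cvg_id.
rewrite mulr0 in h; apply: (squeeze_cvgr _ (@cvg_cst _ _ _ _ _) h).
by apply: nearW => y; rewrite normr_ge0 /=.
Qed.

Lemma cvgn_near (R : realType) (V : normedModType R) (u w : nat -> V) (z : V)
    (e : nat -> R) :
  w @ \oo --> z -> e @ \oo --> 0 -> (\forall k \near \oo, `|u k - w k| <= e k) ->
  u @ \oo --> z.
Proof.
move=> wz e0 uw.
have d : (fun k => u k - w k) @ \oo --> 0.
  apply/norm_cvg0P; apply: (squeeze_cvgr _ (@cvg_cst _ _ _ _ _) e0).
  by apply: filterS uw => k ->; rewrite normr_ge0.
have -> : u = (fun k => (u k - w k) + w k).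
  by apply/funext => k; rewrite subrK.
by rewrite -[z]add0r; exact: cvgD.
Qed.

Lemma cvgn_dist (R : realType) (V : normedModType R) (u : nat -> V) (l : V) :
  (forall e : R, 0 < e -> exists N, forall i, (N <= i)%N -> `|u i - l| <= e) ->
  u @ \oo --> l.
Proof.
move=> ul; apply/cvgrPdist_le => e /ul[N hN]; exists N => // i /hN.
by rewrite distrC.
Qed.

Section pair_limits.
Context {R : realType} {V W : normedModType R}.

Lemma cvgn_pair (u : nat -> V) (v : nat -> W) (x : V) (y : W) :
  u @ \oo --> x -> v @ \oo --> y -> (fun k => (u k, v k)) @ \oo --> (x, y).
Proof. by move=> ux vy; exact: cvg_pair. Qed.

Lemma cvgn_fst (u : nat -> V * W) (x : V * W) :
  u @ \oo --> x -> (fun k => (u k).1) @ \oo --> x.1.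
Proof. by move=> ux; exact: cvg_comp ux cvg_fst. Qed.

Lemma cvgn_snd (u : nat -> V * W) (x : V * W) :
  u @ \oo --> x -> (fun k => (u k).2) @ \oo --> x.2.
Proof. by move=> ux; exact: cvg_comp ux cvg_snd. Qed.

End pair_limits.

(* Caristi's principle, with the sequence of the usual proof of Ekeland's
   variational principle. *)
Lemma descent_zero (R : realType) (V : normedModType R) (phi : V -> R)
    (sigma r : R) (s0 : V) :
  seq_complete V -> continuous phi -> (forall s, 0 <= phi s) ->
  0 < sigma -> phi s0 < sigma * r ->
  (forall s, `|s - s0| < r -> 0 < phi s ->
     exists2 s', phi s' < phi s & phi s' + sigma * `|s' - s| <= phi s) ->
  exists2 s, phi s = 0 & sigma * `|s - s0| <= phi s0.
Proof.
move=> Vc phic phi0 sg0 phir H.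
pose le s s' := phi s' + sigma * `|s' - s| <= phi s.
have le_refl s : le s s by rewrite /le subrr normr0 mulr0 addr0.
have le_tr s1 s2 s3 : le s1 s2 -> le s2 s3 -> le s1 s3.
  rewrite /le => h12 h23.
  have : sigma * `|s3 - s1| <= sigma * (`|s3 - s2| + `|s2 - s1|).
    by rewrite ler_pM2l//; exact: ler_distD.
  by rewrite mulrDr; lra.
have lephi s s' : le s s' -> phi s' <= phi s.
  by apply: le_trans; rewrite lerDl mulr_ge0// ltW.
(* A near-minimizer of phi over the points below s in the order [le]: it closes at least half of the
   gap to every competitor. *)
have nextP s : exists s1, le s s1 /\
    forall s2, le s s2 -> phi s1 <= (phi s + phi s2) / 2.
  pose E := [set phi s2 | s2 in le s].
  have hE : has_inf E.
    by split; [exists (phi s); exists s|exists 0 => _ [x _ <-]].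
  have mE s2 : le s s2 -> inf E <= phi s2.
    by move=> ss2; apply: ge_inf; [exact: hE.2|exists s2].
  have [ms|ms] := leP (phi s) (inf E).
    by exists s; split=> // s2 /mE; lra.
  have e0 : 0 < (phi s - inf E) / 2 by rewrite divr_gt0 ?subr_gt0.
  have [_ [s1 ss1 <-] hs1] := inf_adherent e0 hE.
  by exists s1; split=> // s2 /mE; lra.
have [next nextH] := choice nextP.
pose u k := iter k next s0.
have uS k : le (u k) (u k.+1) by rewrite /u /=; have [] := nextH (iter k next s0).
have uD k j : le (u k) (u (k + j)%N).
  by elim: j => [|j IH]; rewrite ?addn0 ?addnS//; exact: le_tr IH (uS _).
have ule k j : (k <= j)%N -> le (u k) (u j) by move=> /subnKC <-.
have dec : nonincreasing_seq (phi \o u).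
  by move=> i j ij; apply: lephi; exact: ule.
have lbu : has_lbound (range (phi \o u)) by exists 0 => _ [k _ <-] /=.
have cphi := nonincreasing_cvgn dec lbu.
set m := inf _ in cphi.
have mle k : m <= phi (u k) by apply: ge_inf => //; exists k.
have [sb usb] : exists l : V, u @ \oo --> l.
  apply: Vc => e e0.
  have /cvgr_lt/(_ (m + sigma * (e / 2))) := cphi.
  rewrite ltrDl mulr_gt0 ?divr_gt0// => /(_ isT)[N _ HN].
  have key i : (N <= i)%N -> `|u i - u N| <= e / 2.
    move=> Ni; have := ule _ _ Ni; rewrite /le.
    have := HN N (leqnn _); have := mle i; rewrite /= => h1 h2 h3.
    by rewrite -(ler_pM2l sg0); lra.
  exists N => i j /key hi /key; rewrite distrC => hj.
  by have := ler_distD (u N) (u i) (u j); lra.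
have phisb : (phi \o u) @ \oo --> phi sb by apply: cvg_comp usb _; exact: phic.
have msb : m = phi sb by apply: cvg_unique cphi phisb.
have usble k : le (u k) sb.
  rewrite /le.
  have hc : (fun j => phi (u j) + sigma * `|u j - u k|) @ \oo -->
      phi sb + sigma * `|sb - u k|.
    apply: cvgD => //; apply: cvgMr; apply: cvg_norm.
    by apply: cvgB => //; exact: cvg_cst.
  by apply: (cvgn_le_cst hc); exists k => // j kj; exact: ule.
(* The bound phi s0 < sigma r keeps the limit in the ball where [H] provides descent. *)
have sbr : `|sb - s0| < r.
  have := usble 0%N; rewrite /le /u /= => h.
  rewrite -(ltr_pM2l sg0) (le_lt_trans _ phir)//.
  by have := phi0 sb; lra.
exists sb; last by have := usble 0%N; rewrite /le /u /=; have := phi0 sb; lra.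
apply/eqP; rewrite eq_le phi0 andbT leNgt; apply/negP => sb0.
have [s' s'lt s'le] := H _ sbr sb0.
(* The point s' lies below every u k, hence competes at each step; in the limit phi sb <= (phi sb +
   phi s') / 2, against phi s' < phi sb. *)
have h k : phi (u k.+1) <= (phi (u k) + phi s') / 2.
  by rewrite /u /=; apply: (nextH _).2; exact: le_tr (usble k) s'le.
have : phi sb <= (phi sb + phi s') / 2.
  have c1 : (fun k => (phi (u k) + phi s') / 2) @ \oo --> (phi sb + phi s') / 2.
    by apply: cvgMl; apply: cvgD => //; exact: cvg_cst.
  apply: (cvgn_ge_cst c1); exists 0%N => // k _ /=.
  by apply: le_trans (h k); rewrite -msb.
by lra.
Qed.

(** * Directional derivative of the resolvent *)

(** The steps 1/(k+1) are enough: a tangent vector requires a single sequence of steps, and so do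
    the descent and monotonicity arguments. *)
Definition dir_deriv (R : realType) (V W : normedModType R) (P : V -> W)
    (s d : V) (z : W) :=
  (fun k : nat => k.+1%:R *: (P (s + k.+1%:R^-1 *: d) - P s)) @ \oo --> z.

Section resolvent.
Context {R : realType} {Y : preHilbertType R}.
Variables (gamma : R) (P : Y -> Y) (S : Y -> set Y) (V : Y -> Y -> set Y).
Hypothesis gamma0 : 0 <= gamma.
Hypothesis coco : forall s1 s2,
  (1 + gamma) * `|P s1 - P s2| ^+ 2 <= dot (s1 - s2) (P s1 - P s2).
Hypothesis SP : forall v eta, S v eta <-> v = P (v + eta).
Hypothesis PD : forall s d, exists z, dir_deriv P s d z.
Hypothesis VS : forall v eta, S v eta -> forall dv,
  (V v eta dv -> conv_graph_deriv S v eta dv =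
    [set gamma *: dv + z | z in polar (V v eta)]) /\
  (~ V v eta dv -> conv_graph_deriv S v eta dv = set0).

Lemma resolvent_lip s1 s2 : `|P s1 - P s2| <= `|s1 - s2|.
Proof.
have := coco s1 s2; set x := P s1 - P s2 => h.
have [->|x0] := eqVneq x 0; first by rewrite normr0.
have xp : 0 < `|x| by rewrite normr_gt0.
rewrite -(ler_pM2r xp) (le_trans _ (dot_le _ _))// (le_trans _ h)// -expr2.
by rewrite ler_peMl ?sqr_ge0// lerDl.
Qed.

Lemma resolvent_continuous : continuous P.
Proof.
by apply: (@lip_continuous _ _ _ _ 1) => s t; rewrite mul1r resolvent_lip.
Qed.

Lemma graph_resolvent s : S (P s) (s - P s).
Proof. by apply/SP; rewrite subrKC. Qed.

Section at_point.
Variable s : Y.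
Local Notation C := (V (P s) (s - P s)).

Lemma dir_deriv_tangent d z :
  dir_deriv P s d z -> tangent (graph S) (P s, s - P s) (z, d - z).
Proof.
move=> Pz.
exists (fun k => k.+1%:R^-1).
exists (fun k => (P (s + k.+1%:R^-1 *: d),
  s + k.+1%:R^-1 *: d - P (s + k.+1%:R^-1 *: d))); split.
- by move=> k; rewrite invr_gt0.
- exact: cvg_harmonic.
- by move=> k; exact: graph_resolvent.
have h (k : nat) : (k.+1%:R^-1)^-1 *: ((P (s + k.+1%:R^-1 *: d),
  s + k.+1%:R^-1 *: d - P (s + k.+1%:R^-1 *: d)) - (P s, s - P s)) =
  (k.+1%:R *: (P (s + k.+1%:R^-1 *: d) - P s),
   d - k.+1%:R *: (P (s + k.+1%:R^-1 *: d) - P s)).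
  rewrite invrK; congr pair => /=.
  set p := P (_ + _).
  by dot_field; rewrite addrC natr1 pnatr_eq0.
under eq_fun do rewrite h.
apply: cvg_pair => //; apply: cvgB => //; exact: cvg_cst.
Qed.

(** The tangent (z, d - z) lies in the convex hull described by [VS]. The hull is thus nonempty over
    z, which forces z into C and makes d - z a sum of gamma z and a polar vector. *)
Lemma dir_deriv_cone d z : dir_deriv P s d z ->
  C z /\ polar C (d - (1 + gamma) *: z).
Proof.
move=> /dir_deriv_tangent zT.
have hz : conv_graph_deriv S (P s) (s - P s) z (d - z) by move=> B [_ AB]; exact: AB.
have [Vz nVz] := VS (graph_resolvent s) z.
have [Cz|/nVz h] := pselect (C z); last by rewrite h in hz.
split=> //; move: hz; rewrite (Vz Cz) => -[nu Cnu h].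
suff -> : d - (1 + gamma) *: z = nu by [].
by rewrite -[d](subrK z) -h; dot_ring.
Qed.

(** The difference quotients inherit this sign from [coco]; polarity gives the opposite one. *)
Lemma dir_deriv_ge0 d z : dir_deriv P s d z -> 0 <= dot z (d - (1 + gamma) *: z).
Proof.
move=> Pz.
have Pz' : (fun k : nat => d - (1 + gamma) *:
    (k.+1%:R *: (P (s + k.+1%:R^-1 *: d) - P s))) @ \oo --> d - (1 + gamma) *: z.
  by apply: cvgB; [exact: cvg_cst|apply: cvgZ => //; exact: cvg_cst].
apply: (cvgn_ge_cst (cvgn_dot Pz Pz')); apply: nearW => k.
have := coco (s + k.+1%:R^-1 *: d) s; set x := P _ - P s.
rewrite [s + _]addrC addrK normr_sqr_dot dotZl => h.
rewrite dotZl dotBr !dotZr dotC mulr_ge0// mulrCA subr_ge0.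
have k0 : 0 < k.+1%:R :> R by [].
by rewrite -(ler_pM2l k0) mulVKf ?lt0r_neq0// in h.
Qed.

Lemma dir_deriv_orth d z :
  dir_deriv P s d z -> dot z (d - (1 + gamma) *: z) = 0.
Proof.
move=> Pz; have [Cz Cnu] := dir_deriv_cone Pz.
by apply/eqP; rewrite eq_le (dir_deriv_ge0 Pz) andbT dotC; exact: Cnu.
Qed.

(* The directional derivative is the projection onto the cone C, up to the
   factor 1 + gamma. *)
Lemma dir_deriv_proj z nu p : C z -> polar C nu -> dot z nu = 0 ->
  dir_deriv P s ((1 + gamma) *: z + nu) p -> p = z.
Proof.
move=> Cz Cnu znu Pp; have [Cp Cq] := dir_deriv_cone Pp.
have pq := dir_deriv_ge0 Pp; set q := _ + nu - _ in Cq pq.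
apply/eqP; rewrite -subr_eq0; apply/eqP/dot_eq0/eqP; rewrite eq_le dot_ge0 andbT.
have a0 : 0 < 1 + gamma by rewrite ltr_pwDl.
rewrite -(ler_pM2l a0) mulr0.
(* Moreau's argument: of the four products in <p - z, nu - q>, <p, nu> and <z, q> are nonpositive,
   <z, nu> vanishes and <p, q> is nonnegative. *)
have -> : (1 + gamma) * dot (p - z) (p - z) = dot (p - z) (nu - q).
  by rewrite -dotZr; congr dot; rewrite /q; dot_ring.
clearbody q; rewrite dotBl !dotBr znu.
have := Cnu _ Cp; have := Cq _ Cz; rewrite (dotC nu) (dotC q); lra.
Qed.

End at_point.
End resolvent.

(** * Solvability by descent *)

Lemma linear_le_continuous (R : realType) (V W : normedModType R)
    (f : {linear V -> W}) (b : R) :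
  (forall x, `|f x| <= b * `|x|) -> continuous f.
Proof.
by move=> fb; apply: (@lip_continuous _ _ _ _ b) => x y; rewrite -linearB.
Qed.

(** The bound on h makes the quadratic term cost at most half of the linear gain, so |r - h c|^2 <=
    (1 - h q) |r|^2 <= (1 - h q / 2)^2 |r|^2. *)
Lemma normr_step_le (R : realType) (Y : preHilbertType R) (r c : Y) (h q : R) :
  0 <= h -> 0 <= 1 - h * q / 2 ->
  q * `|r| ^+ 2 <= dot r c -> h * `|c| ^+ 2 <= q * `|r| ^+ 2 ->
  `|r - h *: c| <= (1 - h * q / 2) * `|r|.
Proof.
move=> h0 hq angle hk.
rewrite -(@ler_pXn2r _ 2) ?nnegrE ?mulr_ge0// exprMn.
rewrite [in leLHS]normr_sqr_dot !(dotBl, dotBr, dotZl, dotZr) (dotC c r).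
rewrite -!normr_sqr_dot.
have := ler_wpM2l h0 angle; have := ler_wpM2l h0 hk.
have := mulr_ge0 (sqr_ge0 (h * q)) (sqr_ge0 `|r|).
set R2 := `|r| ^+ 2; set C2 := `|c| ^+ 2; lra.
Qed.

(** Young's inequality bounds b |z| |nu| by kap/2 |z|^2 + b^2/(2 kap) |nu|^2; the summand 1 leaves a
    full |nu|^2 over. *)
Definition polar_weight (R : realType) (b kap : R) := b ^+ 2 / (2 * kap) + 1.

(** Chosen so that q <= 1 and q (1 + gamma)^2 <= kap / 2, the shares left for |nu|^2 and |z|^2. *)
Definition angle_rate (R : realType) (gamma kap : R) :=
  kap / (2 * (1 + gamma) ^+ 2 + kap).

(** A step of size h lowers the residual by at least h q |r| / 4 and moves s by at most h (1 + mu)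
    |r|. *)
Definition descent_rate (R : realType) (gamma b kap : R) :=
  angle_rate gamma kap / (4 * (1 + polar_weight b kap)).

Section saddle_operator.
Context {R : realType} {Y : preHilbertType R}.
Variables (gamma : R) (P : Y -> Y) (S : Y -> set Y) (V : Y -> Y -> set Y).
Hypothesis gamma0 : 0 <= gamma.
Hypothesis coco : forall s1 s2,
  (1 + gamma) * `|P s1 - P s2| ^+ 2 <= dot (s1 - s2) (P s1 - P s2).
Hypothesis SP : forall v eta, S v eta <-> v = P (v + eta).
Hypothesis PD : forall s d, exists z, dir_deriv P s d z.
Hypothesis VS : forall v eta, S v eta -> forall dv,
  (V v eta dv -> conv_graph_deriv S v eta dv =
    [set gamma *: dv + z | z in polar (V v eta)]) /\
  (~ V v eta dv -> conv_graph_deriv S v eta dv = set0).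

Variables (B : {linear Y -> Y}) (b : R).
Hypothesis b0 : 0 < b.
Hypothesis Bb : forall z, `|B z| <= b * `|z|.

(** With v = P s and eta = s - P s this is eta + B v, so [residual_map s = w] says that v solves the
    inclusion of w in S v + B v. *)
Definition residual_map s := s - P s + B (P s).

Variable kap : R.
Hypothesis kap0 : 0 < kap.

Local Notation mu := (polar_weight b kap).
Local Notation q := (angle_rate gamma kap).
Local Notation sigma := (descent_rate gamma b kap).

Definition coercive_on (C : set Y) :=
  forall z, C z -> kap * `|z| ^+ 2 <= dot (B z) z + gamma * `|z| ^+ 2.

Let mu1 : 1 <= mu.
Proof. by rewrite lerDr divr_ge0 ?sqr_ge0 ?mulr_ge0// ltW. Qed.

Let a0 : 0 < 1 + gamma. Proof. by rewrite ltr_pwDl. Qed.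

Let den0 : 0 < 2 * (1 + gamma) ^+ 2 + kap.
Proof. by rewrite addr_gt0// mulr_gt0// exprn_gt0. Qed.

Let q0 : 0 < q. Proof. by rewrite divr_gt0. Qed.

Let q1 : q <= 1.
Proof. by rewrite ler_pdivrMr// mul1r lerDr mulr_ge0// sqr_ge0. Qed.

Let qa : q * (1 + gamma) ^+ 2 <= kap / 2.
Proof.
rewrite /angle_rate mulrAC ler_pdivrMr//.
by have := sqr_ge0 kap; have := kap0; nra.
Qed.

Lemma descent_rate_gt0 : 0 < sigma.
Proof. by rewrite divr_gt0// mulr_gt0// ltr_pwDl//; apply: le_trans mu1. Qed.

(* Split r = (1 + gamma) z + nu along the cone and its polar; scaling nu by mu
   absorbs the cross term <B z, nu>. *)
Lemma descent_angle z nu : coercive_on [set z] -> dot z nu = 0 ->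
  q * `|(1 + gamma) *: z + nu| ^+ 2 <=
  dot ((1 + gamma) *: z + nu) (gamma *: z + mu *: nu + B z).
Proof.
move=> /(_ z erefl) Bz znu.
rewrite !normr_sqr_dot !(dotDl, dotDr, dotZl, dotZr) (dotC nu z) znu -!normr_sqr_dot.
rewrite (dotC z (B z)) (dotC nu (B z)).
have cross : - (b * `|z| * `|nu|) <= dot (B z) nu.
  apply: le_trans (dot_ge _ _); rewrite lerN2.
  by rewrite ler_wpM2r.
have young : b * `|z| * `|nu| <= kap / 2 * `|z| ^+ 2 + b ^+ 2 / (2 * kap) * `|nu| ^+ 2.
  rewrite -subr_ge0.
  have -> : kap / 2 * `|z| ^+ 2 + b ^+ 2 / (2 * kap) * `|nu| ^+ 2 - b * `|z| * `|nu| =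
    (kap * `|z| - b * `|nu|) ^+ 2 / (2 * kap) by field; rewrite lt0r_neq0.
  by rewrite divr_ge0 ?sqr_ge0// mulr_ge0// ltW.
have h1 : (1 + gamma) * (kap * `|z| ^+ 2) <=
    (1 + gamma) * (dot (B z) z + gamma * `|z| ^+ 2) by rewrite ler_pM2l.
have h2 : kap * `|z| ^+ 2 <= (1 + gamma) * (kap * `|z| ^+ 2).
  by rewrite ler_peMl ?lerDl// mulr_ge0 ?sqr_ge0// ltW.
have h3 := ler_wpM2r (sqr_ge0 `|z|) qa.
have h4 := ler_wpM2r (sqr_ge0 `|nu|) q1.
by rewrite /polar_weight; lra.
Qed.

Lemma residual_map_continuous : continuous residual_map.
Proof.
have Pc := resolvent_continuous gamma0 coco.
move=> s; apply: cvgD; first by apply: cvgB => //; exact: Pc.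
apply: cvg_comp (Pc s) _; exact: linear_le_continuous Bb _.
Qed.

Lemma residual_descent s w : coercive_on (V (P s) (s - P s)) ->
  0 < `|w - residual_map s| ->
  exists2 s', `|w - residual_map s'| < `|w - residual_map s| &
    `|w - residual_map s'| + sigma * `|s' - s| <= `|w - residual_map s|.
Proof.
move=> coer; set r := w - residual_map s => r0.
have [z Pz] := PD s r.
have [Cz Cnu] := dir_deriv_cone SP VS Pz.
have znu := dir_deriv_orth coco SP VS Pz.
set nu := r - (1 + gamma) *: z in Cnu znu.
have rE : r = (1 + gamma) *: z + nu by rewrite /nu subrKC.
clearbody nu.
(* Since z is also the derivative of P along g, the residual map has derivative g - z + B z along g,
   which is the vector c below. *)
pose g := (1 + gamma) *: z + mu *: nu.
have Pg : dir_deriv P s g z.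
  have [p Pp] := PD s g.
  suff <- : p = z by [].
  apply: (dir_deriv_proj gamma0 coco SP VS Cz _ _ Pp).
    by move=> y /Cnu; rewrite dotZl => ?; rewrite mulr_ge0_le0// (le_trans _ mu1).
  by rewrite dotZr znu mulr0.
pose c := gamma *: z + mu *: nu + B z.
have angle : q * `|r| ^+ 2 <= dot r c.
  by rewrite rE; apply: descent_angle => // _ ->; exact: coer.
have gr : `|g| <= (1 + mu) * `|r|.
  have r2 : `|r| ^+ 2 = ((1 + gamma) * `|z|) ^+ 2 + `|nu| ^+ 2.
    rewrite {1}rE normr_sqr_dot exprMn !normr_sqr_dot.
    by rewrite !(dotDl, dotDr, dotZl, dotZr) (dotC nu) znu; ring.
  have zr : (1 + gamma) * `|z| <= `|r|.
    by rewrite -(@ler_pXn2r _ 2) ?nnegrE ?mulr_ge0 ?(ltW a0)// r2 lerDl sqr_ge0.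
  have nur : `|nu| <= `|r|.
    by rewrite -(@ler_pXn2r _ 2) ?nnegrE// r2 lerDr sqr_ge0.
  apply: le_trans (ler_normD _ _) _; rewrite !normrZ mulrDl mul1r.
  rewrite !ger0_norm ?(ltW a0) ?(le_trans _ mu1)// lerD// ler_pM2l//.
  exact: lt_le_trans mu1.
have e0 : 0 < q * `|r| ^+ 2 / (`|c| ^+ 2 + 1).
  by apply: divr_gt0; [rewrite mulr_gt0 ?exprn_gt0|rewrite ltr_wpDl ?sqr_ge0].
have q4 : 0 < q / 4 by rewrite divr_gt0.
have eps0 : 0 < q / 4 * `|r| / (1 + b) by rewrite divr_gt0 ?addr_gt0// mulr_gt0.
near \oo => k.
have hk : k.+1%:R^-1 * `|c| ^+ 2 <= q * `|r| ^+ 2.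
  have : k.+1%:R^-1 < q * `|r| ^+ 2 / (`|c| ^+ 2 + 1).
    by near: k; exact: near_harmonic_lt.
  rewrite ltr_pdivlMr ?ltr_wpDl ?sqr_ge0// => /ltW; apply: le_trans.
  by rewrite ler_wpM2l// lerDl.
have zkE : `|z - k.+1%:R *: (P (s + k.+1%:R^-1 *: g) - P s)| <=
    q / 4 * `|r| / (1 + b).
  by near: k; move/cvgrPdist_le: Pg; exact.
set h := k.+1%:R^-1 in hk zkE.
have h0 : 0 < h by rewrite invr_gt0.
have h1 : h <= 1 by rewrite invf_le1// ler1n.
set zk := k.+1%:R *: (P (s + h *: g) - P s) in zkE.
have Psk : P (s + h *: g) = P s + h *: zk.
  by rewrite /zk scalerA mulVf ?pnatr_eq0// scale1r subrKC.
have main : `|w - residual_map (s + h *: g)| <= `|r| - h * (q / 4) * `|r|.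
  (* The linear part gains h q |r| / 2; the error of replacing zk by z returns at most half of
     it. *)
  have -> : w - residual_map (s + h *: g) = (r - h *: c) - h *: (z - zk - B (z - zk)).
    rewrite /r /residual_map Psk.
    rewrite [B (_ + h *: zk)]linearD [B (h *: zk)]linearZ [B (z - zk)]linearB /=.
    rewrite /c /g; clearbody zk h; dot_ring.
  have d1 : `|r - h *: c| <= (1 - h * q / 2) * `|r|.
    have hq : 0 <= 1 - h * q / 2 by have := mulr_ile1 (ltW h0) (ltW q0) h1 q1; lra.
    exact: normr_step_le (ltW h0) hq angle hk.
  have d2 : `|z - zk - B (z - zk)| <= q / 4 * `|r|.
    apply: le_trans (ler_normB _ _) _; apply: le_trans (lerD (lexx _) (Bb _)) _.
    rewrite -[X in X + _]mul1r -mulrDl mulrC.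
    by rewrite -ler_pdivlMr// ltr_pwDl// ltW.
  apply: le_trans (ler_normB _ _) _; rewrite normrZ (gtr0_norm h0).
  have := ler_wpM2l (ltW h0) d2; lra.
have hqr : 0 < h * (q / 4) * `|r| by do 2?apply: mulr_gt0.
exists (s + h *: g); first by lra.
rewrite addrAC subrr add0r normrZ (gtr0_norm h0).
have mu2 : 0 < 1 + mu by rewrite ltr_pwDl// (le_trans _ mu1).
have : sigma * (h * `|g|) <= h * (q / 4) * `|r|.
  have -> : h * (q / 4) * `|r| = sigma * (h * ((1 + mu) * `|r|)).
    by rewrite /descent_rate; field; rewrite lt0r_neq0.
  rewrite ler_pM2l; last exact: descent_rate_gt0.
  by rewrite ler_pM2l.
lra.
Unshelve. all: by end_near. Qed.

(** Half of the radius t is spent on the starting point and half on the descent path, so coercivity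
    holds wherever [descent_zero] asks for it. *)
Lemma residual_solve shat t s0 w : seq_complete Y ->
  (forall s, `|s - shat| < t -> coercive_on (V (P s) (s - P s))) ->
  `|s0 - shat| < t / 2 -> `|w - residual_map s0| < sigma * (t / 2) ->
  exists2 s, residual_map s = w & sigma * `|s - s0| <= `|w - residual_map s0|.
Proof.
move=> Yc coer s0t wt.
have [] := @descent_zero R Y (fun s => `|w - residual_map s|) sigma (t / 2) s0 Yc.
- move=> s; apply: cvg_norm; apply: cvgB; first exact: cvg_cst.
  exact: residual_map_continuous.
- by [].
- exact: descent_rate_gt0.
- by [].
- move=> s ss0; apply: residual_descent; apply: coer.
  by have := ler_distD s0 s shat; lra.
by move=> s /normr0_eq0/eqP; rewrite subr_eq0 eq_sym => /eqP sw hs; exists s.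
Qed.

End saddle_operator.

(** * The saddle relation *)

Section hilbert_prod_theory.
Context {R : realType} {X Y : preHilbertType R}.
Implicit Types p : hilbert_prod X Y.

Lemma hilbert_prod_sqr p : `|p| ^+ 2 = `|p.1| ^+ 2 + `|p.2| ^+ 2.
Proof. by rewrite !normr_sqr_dot. Qed.

Lemma hilbert_prod_fst p : `|p.1| <= `|p|.
Proof.
by rewrite -(@ler_pXn2r _ 2) ?nnegrE// hilbert_prod_sqr lerDl sqr_ge0.
Qed.

Lemma hilbert_prod_snd p : `|p.2| <= `|p|.
Proof.
by rewrite -(@ler_pXn2r _ 2) ?nnegrE// hilbert_prod_sqr lerDr sqr_ge0.
Qed.

Lemma hilbert_prod_le p : `|p| <= `|p.1| + `|p.2|.
Proof.
rewrite -(@ler_pXn2r _ 2) ?nnegrE ?addr_ge0// hilbert_prod_sqr sqrrD.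
by rewrite lerD2r lerDl mulrn_wge0// mulr_ge0.
Qed.

Lemma hilbert_prod_fst_continuous : continuous (fun p => p.1 : X).
Proof.
apply: (@lip_continuous _ _ _ _ 1) => p q; rewrite mul1r.
exact: (hilbert_prod_fst (p - q)).
Qed.

Lemma hilbert_prod_snd_continuous : continuous (fun p => p.2 : Y).
Proof.
apply: (@lip_continuous _ _ _ _ 1) => p q; rewrite mul1r.
exact: (hilbert_prod_snd (p - q)).
Qed.

End hilbert_prod_theory.

Section distance.
Context {R : realType} {W Q : normedModType R}.

(** One nearby solution for each residual y suffices; if B is empty, the right-hand side is +oo. *)
Lemma dist_set_le (x : Q) (A : set Q) (B : set W) (w : W) (l : R) : 0 < l ->
  (forall y, B y -> exists2 a, A a & `|x - a| <= l * `|w - y|) ->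
  (dist_set x A <= l%:E * dist_set w B)%E.
Proof.
move=> l0 AB; rewrite -lee_pdivrMl//; apply/ereal_infP => _ [y By <-].
have [a Aa xa] := AB _ By; rewrite lee_pdivrMl// -EFinM.
by apply: ereal_inf_le; exists `|x - a|%:E; [exists a|rewrite lee_fin].
Qed.

Lemma dist_set_lt (x : Q) (A : set Q) (e : R) :
  (dist_set x A < e%:E)%E -> exists2 a, A a & `|x - a| < e.
Proof.
by move=> /ereal_inf_lt[_ [a Aa <-]]; rewrite lte_fin; exists a.
Qed.

End distance.

Section aubin_criterion.
Context {R : realType} {X Y : preHilbertType R}.
Variables (gamma : R) (P : Y -> Y) (S : Y -> set Y) (V : Y -> Y -> set Y).
Hypothesis gamma0 : 0 <= gamma.
Hypothesis coco : forall s1 s2,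
  (1 + gamma) * `|P s1 - P s2| ^+ 2 <= dot (s1 - s2) (P s1 - P s2).
Hypothesis SP : forall v eta, S v eta <-> v = P (v + eta).
Hypothesis PD : forall s d, exists z, dir_deriv P s d z.
Hypothesis VS : forall v eta, S v eta -> forall dv,
  (V v eta dv -> conv_graph_deriv S v eta dv =
    [set gamma *: dv + z | z in polar (V v eta)]) /\
  (~ V v eta dv -> conv_graph_deriv S v eta dv = set0).
Variables (alpha nA : R) (A : {linear X -> Y}) (As : {linear Y -> X}) (c : Y).
Hypothesis alpha0 : 0 < alpha.
Hypothesis nA0 : 0 < nA.
Hypothesis A_le : forall x, `|A x| <= nA * `|x|.
Hypothesis adj : forall x y, dot (A x) y = dot x (As y).

Definition saddle_rel (q : hilbert_prod X Y) : set (hilbert_prod X Y) :=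
  [set w | w.1 = alpha *: q.1 + As q.2 /\ S q.2 (w.2 + A q.1 + c)].

(** The Schur complement: inserting u = alpha^-1 (w_1 - As v) into the second row leaves w_2 + c +
    alpha^-1 A w_1 in S v + schur v. *)
Definition schur : {linear Y -> Y} := alpha^-1 \*: (A \o As).

Lemma schurE z : schur z = alpha^-1 *: A (As z).
Proof. by []. Qed.

Lemma adjoint_le y : `|As y| <= nA * `|y|.
Proof.
have [->|y0] := eqVneq (As y) 0; first by rewrite normr0 mulr_ge0// ltW.
have yp : 0 < `|As y| by rewrite normr_gt0.
rewrite -(ler_pM2r yp) -expr2 normr_sqr_dot -adj.
by apply: le_trans (dot_le _ _) _; rewrite mulrAC ler_wpM2r.
Qed.

Lemma dot_schur y z : dot (schur y) z = alpha^-1 * dot (As y) (As z).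
Proof. by rewrite schurE dotZl adj. Qed.

Lemma dot_schurC y z : dot (schur y) z = dot (schur z) y.
Proof. by rewrite !dot_schur dotC. Qed.

Lemma dot_schur_ge0 z : 0 <= dot (schur z) z.
Proof. by rewrite dot_schur mulr_ge0 ?dot_ge0// invr_ge0 ltW. Qed.

Local Notation b := (alpha^-1 * nA ^+ 2).

Let b0 : 0 < b.
Proof. by rewrite mulr_gt0 ?invr_gt0 ?exprn_gt0. Qed.

Lemma schur_le z : `|schur z| <= b * `|z|.
Proof.
rewrite schurE normrZ gtr0_norm ?invr_gt0// -mulrA ler_pM2l ?invr_gt0//.
apply: le_trans (A_le _) _; rewrite expr2 -mulrA ler_pM2l//; exact: adjoint_le.
Qed.

(* Z stands for hilbert_prod X Y, whose filters are found by inference only when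
   the type is abstract. *)
Lemma closed_saddle (Z : normedModType R) (pX : Z -> X) (pY : Z -> Y) :
  continuous pX -> continuous pY ->
  closed [set p : Z * Z | pX p.2 = alpha *: pX p.1 + As (pY p.1) /\
    S (pY p.1) (pY p.2 + A (pX p.1) + c)].
Proof.
move=> pXc pYc.
have Pc := resolvent_continuous gamma0 coco.
have Ac := linear_le_continuous A_le.
have Asc := linear_le_continuous adjoint_le.
have c1 : continuous (fun p : Z * Z => pX p.1).
  by move=> p; apply: (continuous_comp (f := fst) (g := pX)); [exact: cvg_fst|exact: pXc].
have c2 : continuous (fun p : Z * Z => pY p.1).
  by move=> p; apply: (continuous_comp (f := fst) (g := pY)); [exact: cvg_fst|exact: pYc].
have c3 : continuous (fun p : Z * Z => pX p.2).
  by move=> p; apply: (continuous_comp (f := snd) (g := pX)); [exact: cvg_snd|exact: pXc].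
have c4 : continuous (fun p : Z * Z => pY p.2).
  by move=> p; apply: (continuous_comp (f := snd) (g := pY)); [exact: cvg_snd|exact: pYc].
pose f1 (p : Z * Z) := pX p.2 - (alpha *: pX p.1 + As (pY p.1)).
pose f2 (p : Z * Z) := pY p.1 - P (pY p.1 + (pY p.2 + A (pX p.1) + c)).
rewrite [X in closed X](_ : _ = f1 @^-1` [set 0] `&` f2 @^-1` [set 0]); last first.
  apply/seteqP; split => -[p w] /=.
    by move=> [h1 /SP h2]; rewrite /f1 /f2 /= h1 -h2; split; exact: subrr.
  move=> [/eqP h1 /eqP h2]; split; first by apply/eqP; rewrite -subr_eq0.
  by apply/SP/eqP; rewrite -subr_eq0.
apply: closedI; apply: preimage_closed.
- move=> p _; apply: cvgB; first exact: c3.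
  apply: cvgD; first by apply: cvgZ; [exact: cvg_cst|exact: c1].
  by apply: cvg_comp (c2 p) _; exact: Asc.
- exact/accessible_closed_set1/hausdorff_accessible/norm_hausdorff.
- move=> p _; apply: cvgB; first exact: c2.
  apply: cvg_comp; last exact: Pc.
  apply: cvgD; first exact: c2.
  apply: cvgD; last exact: cvg_cst.
  apply: cvgD; first exact: c4.
  by apply: cvg_comp (c1 p) _; exact: Ac.
- exact/accessible_closed_set1/hausdorff_accessible/norm_hausdorff.
Qed.

Lemma saddle_solve (kap : R) : 0 < kap -> seq_complete Y ->
  exists sg l : R, [/\ 0 < sg, 0 < l &
    forall shat t (q w y : hilbert_prod X Y), 
      (forall s, `|s - shat| < t ->
         coercive_on gamma schur kap (V (P s) (s - P s))) ->
      saddle_rel q y -> `|q.2 + (y.2 + A q.1 + c) - shat| < t / 2 ->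
      `|w - y| < sg * t ->
      exists2 p, saddle_rel p w & `|q - p| <= l * `|w - y|].
Proof.
move=> kap0 Yc; pose sg := descent_rate gamma b kap.
have sg0 : 0 < sg by exact: descent_rate_gt0.
have ai0 : 0 < alpha^-1 by rewrite invr_gt0.
(* [k1] bounds the dependence of the reduced right-hand side w_2 + c + alpha^-1 A w_1 on w. In the
   second constant, k1 / sg is the error of v and the rest is the error of u recovered from v and
   w_1. *)
pose k1 := 1 + alpha^-1 * nA.
have k10 : 0 < k1 by rewrite addr_gt0// mulr_gt0.
exists (sg / (2 * k1)), (k1 / sg + alpha^-1 * (1 + nA * (k1 / sg))).
have ks0 : 0 < k1 / sg by rewrite divr_gt0.
split.
- by rewrite divr_gt0// mulr_gt0.
- by rewrite addr_gt0// mulr_gt0// addr_gt0// mulr_gt0.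
move=> shat t [u v] w y coer [/= y1 Sy] st wt.
set s0 := v + (y.2 + A u + c) in st.
pose W := w.2 + c + alpha^-1 *: A w.1.
have Ps0 : P s0 = v by rewrite /s0 -(iffLR (SP _ _) Sy).
have WE : W - residual_map P schur s0 = (w.2 - y.2) + alpha^-1 *: A (w.1 - y.1).
  have Asv : As v = y.1 - alpha *: u by rewrite y1; dot_ring.
  rewrite /residual_map Ps0 schurE Asv !linearB /= [A (alpha *: u)]linearZ /= /W /s0.
  by dot_field; rewrite lt0r_neq0.
have Wle : `|W - residual_map P schur s0| <= k1 * `|w - y|.
  rewrite WE /k1 mulrDl mul1r; apply: le_trans (ler_normD _ _) _; apply: lerD.
    exact: (hilbert_prod_snd (w - y)).
  rewrite normrZ gtr0_norm// -mulrA ler_pM2l//; apply: le_trans (A_le _) _.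
  by rewrite ler_pM2l//; exact: (hilbert_prod_fst (w - y)).
have [] := residual_solve gamma0 coco SP PD VS b0 schur_le kap0 Yc coer st (w := W).
  apply: le_lt_trans Wle _.
  have := wt; rewrite -(ltr_pM2l k10) => /lt_le_trans; apply.
  rewrite -/sg le_eqVlt; apply/orP; left; apply/eqP; field; exact: lt0r_neq0.
rewrite -/sg => s sW sle.
have vle : `|v - P s| <= k1 / sg * `|w - y|.
  rewrite -Ps0; apply: le_trans (resolvent_lip gamma0 coco _ _) _.
  by rewrite distrC mulrAC ler_pdivlMr// mulrC (le_trans sle).
pose u' := alpha^-1 *: (w.1 - As (P s)).
exists (u', P s).
  split => /=; first by rewrite /u'; dot_field; rewrite lt0r_neq0.
  apply/SP; congr P; rewrite /u' linearZ linearB /=.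
  suff : s = P s + (W - schur (P s)).
    by move=> {1}->; rewrite schurE /W; dot_ring.
  by rewrite -sW /residual_map; dot_ring.
apply: le_trans (hilbert_prod_le _) _; rewrite /= addrC [leRHS]mulrDl.
apply: lerD; first exact: vle.
have -> : u - u' = alpha^-1 *: ((y.1 - w.1) - As (v - P s)).
  rewrite /u' y1 [As (v - P s)]linearB /=; dot_field; exact: lt0r_neq0.
rewrite normrZ gtr0_norm// -mulrA ler_pM2l//.
apply: le_trans (ler_normB _ _) _; rewrite mulrDl mul1r; apply: lerD.
  rewrite distrC; exact: (hilbert_prod_fst (w - y)).
apply: le_trans (adjoint_le _) _.
by rewrite -[leRHS]mulrA; apply: ler_wpM2l vle; exact: ltW.
Qed.

Lemma coercive_aubin (kap t : R) (uhat : X) (vhat : Y) :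
  0 < kap -> 0 < t -> seq_complete Y ->
  saddle_rel (uhat, vhat) 0 ->
  (forall s, `|s - (vhat + (A uhat + c))| < t ->
     coercive_on gamma schur kap (V (P s) (s - P s))) ->
  aubin (inverse saddle_rel) 0 (uhat, vhat).
Proof.
move=> kap0 t0 Yc Hhat coer.
have [sg [l [sg0 l0 solve]]] := saddle_solve kap0 Yc.
(* For q within d of the reference point and |y| < r1 <= d, the parameter s moves by at most (2 +
   nA) d, which is below t / 2 = 2 m d. *)
pose m := 3 + nA.
pose d := t / (4 * m).
have m0 : 0 < m by rewrite addr_gt0.
have d0 : 0 < d by rewrite divr_gt0// mulr_gt0.
pose r1 := Num.min d (sg * t / 2).
have r10 : 0 < r1 by rewrite lt_min d0 divr_gt0// mulr_gt0.
split=> //.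
  exists setT; split; [exact: filterT|exact: closedT|rewrite setIT].
  exact: closed_saddle hilbert_prod_fst_continuous hilbert_prod_snd_continuous.
exists (r1 / 2), d, (l + 2 * (d + l * (r1 / 2)) / r1); split=> //.
- by rewrite divr_gt0.
- by rewrite addr_gt0// divr_gt0// mulr_gt0// addr_gt0// mulr_gt0// divr_gt0.
move=> q w qd wr; rewrite subr0 in wr.
have rh0 : 0 < r1 / 2 by rewrite divr_gt0.
have e0 : 0 < d + l * (r1 / 2) by apply: addr_gt0 => //; exact: mulr_gt0.
set L := l + _; have lL : l <= L.
  by rewrite lerDl; apply/ltW/divr_gt0 => //; exact: mulr_gt0.
apply: dist_set_le; first exact: lt_le_trans lL.
move=> y Hy.
have step (q0 y0 : hilbert_prod X Y) : `|q0 - (uhat, vhat)| <= d -> `|y0| < r1 ->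
    saddle_rel q0 y0 ->
    exists2 p, saddle_rel p w & `|q0 - p| <= l * `|w - y0|.
  move=> q0d y0r Hq0; apply: (solve _ _ _ _ _ coer) => //.
    have -> : q0.2 + (y0.2 + A q0.1 + c) - (vhat + (A uhat + c)) =
        (q0.2 - vhat) + (y0.2 + A (q0.1 - uhat)) by rewrite linearB /=; dot_ring.
    have h1 := hilbert_prod_fst (q0 - (uhat, vhat)).
    have h2 := hilbert_prod_snd (q0 - (uhat, vhat)).
    have h3 := hilbert_prod_snd y0.
    have h4 := A_le (q0.1 - uhat).
    have h5 : r1 <= d by rewrite ge_min lexx.
    have h6 : nA * `|q0.1 - uhat| <= nA * d.
      by rewrite ler_pM2l// (le_trans h1).
    have h7 : (2 + nA) * d < t / 2.
      have -> : t / 2 = 2 * m * d by rewrite /d; field; rewrite lt0r_neq0.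
      by rewrite ltr_pM2r// /m; have := nA0; lra.
    apply: le_lt_trans h7; apply: le_trans (ler_normD _ _) _.
    have := ler_normD y0.2 (A (q0.1 - uhat)).
    rewrite /= in h1 h2; lra.
  have : r1 <= sg * t / 2 by rewrite ge_min lexx orbT.
  by have := ler_normB w y0; lra.
have [yr|yr] := ltP `|y| r1.
  have [p Hp qp] := step q y qd yr Hy; exists p => //.
  by apply: le_trans qp _; rewrite ler_wpM2r.
(* For a residual y of norm at least r1 the correction starts from the reference point instead. Then
   |q - p| <= d + l r1 / 2 while |w - y| >= r1 / 2, and the second summand of the constant covers
   the ratio. *)
have [||p Hp qp] := step (uhat, vhat) 0 _ _ Hhat.
- by rewrite subrr normr0 ltW.
- by rewrite normr0.
exists p => //.
have h1 : `|q - p| <= d + l * (r1 / 2).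
  apply: le_trans (ler_distD ((uhat, vhat) : hilbert_prod X Y) q p) _; apply: lerD => //.
  by apply: le_trans qp _; rewrite subr0 ler_pM2l.
apply: le_trans h1 _.
have h2 : r1 / 2 <= `|w - y|.
  by have := lerB_normD (y : hilbert_prod X Y) (w - y); rewrite subrKC; lra.
have h3 := ler_wpM2l (mulr_ge0 (ler0n R 2) (ltW e0)) h2.
apply: le_trans (_ : 2 * (d + l * (r1 / 2)) / r1 * `|w - y| <= _); last first.
  by rewrite ler_wpM2r// lerDr ltW.
rewrite mulrAC ler_pdivlMr// (le_trans _ h3)// le_eqVlt.
by apply/orP; left; apply/eqP; field.
Qed.

Lemma resolvent_monotone v1 eta1 v2 eta2 :
  S v1 eta1 -> S v2 eta2 -> 0 <= dot (eta1 - eta2) (v1 - v2).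
Proof.
move=> /SP h1 /SP h2; have := coco (v1 + eta1) (v2 + eta2).
rewrite -h1 -h2 normr_sqr_dot.
have -> : v1 + eta1 - (v2 + eta2) = (v1 - v2) + (eta1 - eta2) by dot_ring.
by rewrite [leRHS]dotDl; have := mulr_ge0 gamma0 (dot_ge0 (v1 - v2)); lra.
Qed.

(* The monotonicity inequality between the perturbed solution and the curve
   through (v, eta) in the direction (z, 0), after division by the step. *)
Lemma monotone_step (eps : R) (z zeta e : Y) : 0 <= eps ->
  `|zeta| <= `|z| / 2 ->
  0 <= dot (eps *: z - schur zeta + e) (zeta - z - e) ->
  eps / 2 * `|z| ^+ 2 <=
    dot (schur z) z / 4 + (2 + eps + b) * `|z| * `|e|.
Proof.
move=> eps0 zz.
have -> : dot (eps *: z - schur zeta + e) (zeta - z - e) =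
   eps * dot z zeta - eps * `|z| ^+ 2 + dot (schur zeta) z - dot (schur zeta) zeta
   + dot e (zeta - z) - dot e e - eps * dot z e + dot (schur zeta) e.
  move: (schur zeta) => Bzeta.
  rewrite normr_sqr_dot !(dotDl, dotDr, dotNl, dotNr, dotZl, dotZr).
  by rewrite (dotC e z); ring.
(* Completing the square: [schur] is symmetric and nonnegative, and it is tested at zeta - z/2. *)
have h1 : dot (schur zeta) z - dot (schur zeta) zeta <= dot (schur z) z / 4.
  have := dot_schur_ge0 (zeta - 2^-1 *: z); have := dot_schurC z zeta.
  have -> : schur (zeta - 2^-1 *: z) = schur zeta - 2^-1 *: schur z.
    rewrite !schurE [As (zeta - _)]linearB [As (2^-1 *: z)]linearZ /=.
    by rewrite [A (As zeta - _)]linearB [A (2^-1 *: _)]linearZ /=; dot_ring.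
  move: (schur z) (schur zeta) => Bz Bzeta BC.
  rewrite !(dotBl, dotBr, dotZl, dotZr) BC; lra.
have h2 : eps * dot z zeta <= eps * (`|z| ^+ 2 / 2).
  rewrite ler_wpM2l// (le_trans (dot_le _ _))// expr2 -mulrA.
  by rewrite ler_wpM2l.
have z0 := normr_ge0 z; have e0 := normr_ge0 e.
have h3 : dot e (zeta - z) <= 2 * `|z| * `|e|.
  apply: le_trans (dot_le _ _) _; rewrite mulrC ler_wpM2r//.
  by apply: le_trans (ler_normB _ _) _; lra.
have h4 : - (eps * dot z e) <= eps * `|z| * `|e|.
  by rewrite -mulrN -mulrA ler_wpM2l// lerNl dot_ge.
have h5 : dot (schur zeta) e <= b * `|z| * `|e|.
  apply: le_trans (dot_le _ _) _; rewrite ler_wpM2r//.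
  apply: le_trans (schur_le _) _; rewrite ler_pM2l//; lra.
have := dot_ge0 e; set N2 := `|z| ^+ 2 in h2 *; lra.
Qed.

Lemma aubin_coercive (uhat : X) (vhat : Y) : gamma = 0 ->
  aubin (inverse saddle_rel) 0 (uhat, vhat) ->
  exists kap t : R, [/\ 0 < kap, 0 < t & forall v eta, S v eta ->
    `|v - vhat| < t -> `|eta - (A uhat + c)| < t ->
    coercive_on gamma schur kap (V v eta)].
Proof.
move=> g0 [[/= Hu HS] _ [rho [delta [l [rho0 delta0 l0 reg]]]]].
have ai0 : 0 < alpha^-1 by rewrite invr_gt0.
(* The summands 1 + alpha^-1 nA control the distance of q to the solution, and 1 + b controls y. *)
pose m := 1 + alpha^-1 * nA + b.
have an0 : 0 < alpha^-1 * nA by rewrite mulr_gt0.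
have m0 : 0 < m by rewrite addr_gt0// addr_gt0.
pose t := Num.min delta (rho / 2) / m.
have t0 : 0 < t by rewrite divr_gt0// lt_min delta0 divr_gt0.
have mtd : m * t <= delta by rewrite /t mulrC mulfVK ?lt0r_neq0// ge_min lexx.
have mtr : m * t <= rho / 2.
  by rewrite /t mulrC mulfVK ?lt0r_neq0// ge_min lexx orbT.
(* The perturbed solution moves by at most l h eps |z| = h |z| / 4. This is strictly below h |z| /
   2, so an actual solution within that distance exists even if the infimum is not attained. *)
pose eps := 1 / (4 * l).
have eps0 : 0 < eps by rewrite divr_gt0// mulr_gt0.
exists (2 * eps), t; split=> //; first by rewrite mulr_gt0.
move=> v eta Sv vt etat z Vz.
rewrite g0 mul0r addr0.
have [->|z0] := eqVneq z 0; first by rewrite normr0 expr0n mulr0 dot_schur_ge0.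
have zp : 0 < `|z| by rewrite normr_gt0.
(* This u annihilates the first residual component, so only the second one has to be perturbed. *)
pose u := - (alpha^-1 *: As v).
have uE : u - uhat = - (alpha^-1 *: As (v - vhat)).
  have -> : uhat = - (alpha^-1 *: As vhat).
    have -> : As vhat = - (alpha *: uhat).
      by apply/eqP; rewrite -addr_eq0 addrC -Hu.
    by dot_field; rewrite lt0r_neq0.
  by rewrite /u [As (v - vhat)]linearB /=; dot_ring.
have ut : `|u - uhat| <= alpha^-1 * nA * t.
  rewrite uE normrN normrZ gtr0_norm// -mulrA ler_pM2l//.
  by apply: le_trans (adjoint_le _) _; rewrite ler_pM2l// ltW.
pose q : hilbert_prod X Y := (u, v).
pose y : hilbert_prod X Y := (0, eta - A u - c).
have Hq : saddle_rel q y.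
  split => /=; first by rewrite /u; dot_field; rewrite lt0r_neq0.
  by rewrite [X in S _ X](_ : _ = eta)//; dot_ring.
have qd : `|q - (uhat, vhat)| <= delta.
  apply: le_trans (hilbert_prod_le _) _; apply: le_trans mtd.
  rewrite /= /m !mulrDl mul1r; have := mulr_gt0 b0 t0; lra.
have yr : `|y| <= rho / 2.
  apply: le_trans (hilbert_prod_le _) _; apply: le_trans mtr.
  rewrite /= normr0 add0r.
  have -> : eta - A u - c = (eta - (A uhat + c)) - A (u - uhat).
    by rewrite linearB /=; dot_ring.
  apply: le_trans (ler_normB _ _) _.
  have h : `|A (u - uhat)| <= b * t.
    apply: le_trans (A_le _) _; apply: le_trans (ler_wpM2l (ltW nA0) ut) _.
    by rewrite le_eqVlt; apply/orP; left; apply/eqP; ring.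
  rewrite /m !mulrDl mul1r; have := mulr_gt0 an0 t0; lra.
have Pv : P (v + eta) = v by rewrite -(iffLR (SP _ _) Sv).
have vetaE : v + eta - P (v + eta) = eta by rewrite Pv addrAC subrr add0r.
have Pz : dir_deriv P (v + eta) z z.
  have [p Pp] := PD (v + eta) z; suff pz : p = z by rewrite pz in Pp.
  apply: (dir_deriv_proj gamma0 coco SP VS (s := v + eta) (nu := 0)).
  - by rewrite vetaE Pv.
  - by move=> x _; rewrite dot0l.
  - exact: dot0r.
  - by rewrite g0 addr0 addr0 scale1r.
suff : eps / 2 * `|z| ^+ 2 <= dot (schur z) z / 4 by lra.
have lim : (fun k : nat => dot (schur z) z / 4 + (2 + eps + b) * `|z| *
    `|k.+1%:R *: (P (v + eta + k.+1%:R^-1 *: z) - P (v + eta)) - z|) @ \oo -->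
    dot (schur z) z / 4 + (2 + eps + b) * `|z| * 0.
  apply: cvgD; first exact: cvg_cst.
  apply: cvgM; first exact: cvg_cst.
  by apply/norm_cvg0P/subr_cvg0.
rewrite mulr0 addr0 in lim.
apply: (cvgn_ge_cst lim).
have er0 : 0 < rho / (2 * eps * `|z|).
  by apply: divr_gt0 => //; apply: mulr_gt0 => //; exact: mulr_gt0.
near=> k.
have hk : k.+1%:R^-1 < rho / (2 * eps * `|z|) by near: k; exact: near_harmonic_lt.
set zk := k.+1%:R *: _; set h := k.+1%:R^-1 in hk zk *.
have h0 : 0 < h by rewrite invr_gt0.
have Pk : P (v + eta + h *: z) = v + h *: zk.
  by rewrite /zk scalerA mulVf ?pnatr_eq0// scale1r Pv subrKC.
pose w : hilbert_prod X Y := y + (0, (h * eps) *: z).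
have wy : `|w - y| <= h * eps * `|z|.
  rewrite /w addrAC subrr add0r; apply: le_trans (hilbert_prod_le _) _.
  by rewrite /= normr0 add0r normrZ gtr0_norm//; exact: mulr_gt0.
have wr : `|w - 0| <= rho.
  have : h * eps * `|z| <= rho / 2.
    move: hk; rewrite ltr_pdivlMr; first by move=> /ltW; lra.
    by apply: mulr_gt0 => //; exact: mulr_gt0.
  have := ler_normD (w - y) y; rewrite subrK subr0; lra.
have : (dist_set q (inverse saddle_rel w) < (h * (`|z| / 2))%:E)%E.
  apply: le_lt_trans (reg q w qd wr) _.
  apply: (@le_lt_trans _ _ (l%:E * (h * eps * `|z|)%:E)%E).
    rewrite lee_pmul2l// ?lte_fin//; apply: ereal_inf_le.
    by exists (`|w - y|)%:E; [exists y|rewrite lee_fin].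
  rewrite -EFinM lte_fin.
  have -> : l * (h * eps * `|z|) = h * (`|z| / 4).
    by rewrite /eps; field; rewrite lt0r_neq0.
  rewrite ltr_pM2l//; lra.
move=> /dist_set_lt[[uh vh] [/= w1 Sh] qp].
pose zeta := k.+1%:R *: (vh - v).
have vhE : vh = v + h *: zeta.
  by rewrite /zeta scalerA mulVf ?pnatr_eq0// scale1r subrKC.
have zetaz : `|zeta| <= `|z| / 2.
  rewrite -(ler_pM2l h0) -[X in X * `|zeta|]gtr0_norm// -normrZ.
  have -> : h *: zeta = vh - v by rewrite vhE; dot_ring.
  apply/ltW; apply: le_lt_trans qp.
  by rewrite distrC; exact: (hilbert_prod_snd (q - (uh, vh))).
have uhE : uh = - (alpha^-1 *: As vh).
  have -> : As vh = - (alpha *: uh) by apply/eqP; rewrite -addr_eq0 addrC -w1 addr0.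
  by dot_field; rewrite lt0r_neq0.
apply: (monotone_step (ltW eps0) zetaz).
have Sk := graph_resolvent SP (v + eta + h *: z).
have := resolvent_monotone Sh Sk.
have -> : eta - A u - c + (h * eps) *: z + A uh + c -
    (v + eta + h *: z - P (v + eta + h *: z)) =
    h *: (eps *: z - schur zeta + (zk - z)).
  have -> : A uh = A u - h *: schur zeta.
    rewrite uhE {1}vhE /u schurE !linearN /= !linearZ /= !linearD /= !linearZ /=.
    by dot_ring.
  by rewrite Pk; dot_ring.
have -> : vh - P (v + eta + h *: z) = h *: (zeta - z - (zk - z)).
  by rewrite Pk {1}vhE; dot_ring.
by rewrite dotZl dotZr (pmulr_rge0 _ h0) (pmulr_rge0 _ h0).
Unshelve. all: by end_near. Qed.

End aubin_criterion.

(** * Adjoints and the modulus *)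

Section riesz.
Context {R : realType} {X : preHilbertType R}.
Hypothesis Xc : seq_complete X.

(* The representing vector minimizes |x|^2/2 - f x. *)
Lemma riesz_representation (f : X -> R) (M : R) :
  (forall x y, f (x + y) = f x + f y) -> (forall a x, f (a *: x) = a * f x) ->
  (forall x, `|f x| <= M * `|x|) -> exists y, forall x, f x = dot x y.
Proof.
move=> fD fZ fM.
pose J x := dot x x / 2 - f x.
have J_lb x : - (M ^+ 2 / 2) <= J x.
  have := fM x; rewrite ler_norml => /andP[_].
  rewrite /J -normr_sqr_dot; have := sqr_ge0 (`|x| - M); nra.
pose E := range J.
have hE : has_inf E.
  by split; [exists (J 0); exists 0|exists (- (M ^+ 2 / 2)) => _ [x _ <-]].
set m := inf E.
have mJ x : m <= J x by apply: ge_inf; [exact: hE.2|exists x].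
have uP (k : nat) : exists x, J x < m + k.+1%:R^-1.
  have k0 : 0 < k.+1%:R^-1 :> R by rewrite invr_gt0.
  by have [_ [x _ <-] xlt] := inf_adherent k0 hE; exists x.
have [u uJ] := choice uP.
(* The parallelogram law with the midpoint as competitor: near-minimizers are close to each
   other. *)
have par x y : dot (x - y) (x - y) <= 4 * (J x + J y - 2 * m).
  have := mJ (2^-1 *: (x + y)); rewrite /J fZ fD.
  rewrite !(dotDl, dotDr, dotNl, dotNr, dotZl, dotZr) (dotC y x); lra.
have [y uy] : exists y : X, u @ \oo --> y.
  apply: Xc => e e0.
  have e80 : 0 < e ^+ 2 / 8 by rewrite divr_gt0// exprn_gt0.
  have [N _ HN] := near_harmonic_lt e80.
  exists N => i j Ni Nj.
  rewrite -(@ler_pXn2r _ 2) ?nnegrE//; last exact: ltW.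
  rewrite normr_sqr_dot; apply/ltW; apply: le_lt_trans (par _ _) _.
  have := uJ i; have := uJ j; have := HN _ Ni; have := HN _ Nj; rewrite /=.
  move: (i.+1%:R^-1) (j.+1%:R^-1) => ri rj; lra.
have fc : (fun k => f (u k)) @ \oo --> f y.
  apply/subr_cvg0/norm_cvg0P.
  have h : (fun k => M * `|u k - y|) @ \oo --> M * 0.
    by apply: cvgM; [exact: cvg_cst|apply/norm_cvg0P/subr_cvg0].
  rewrite mulr0 in h; apply: (squeeze_cvgr _ (@cvg_cst _ _ _ _ _) h).
  apply: nearW => k; rewrite normr_ge0 /= -[- f y]mulN1r -fZ -fD scaleN1r.
  exact: fM.
have Jy : J y <= m.
  have c1 : (fun k => J (u k) - k.+1%:R^-1) @ \oo --> J y - 0.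
    apply: cvgB; last exact: cvg_harmonic.
    apply: cvgB => //; apply: cvgM; last exact: cvg_cst.
    exact: cvgn_dot.
  rewrite subr0 in c1; apply: (cvgn_le_cst c1); apply: nearW => k.
  by rewrite lerBlDr; exact: ltW.
exists y => x; apply/eqP; rewrite -subr_eq0 -sqrf_eq0 eq_le sqr_ge0 andbT.
set d := f x - dot x y; set n := dot x x.
have n1 : 0 < n + 1 by rewrite ltr_wpDl// dot_ge0.
(* The denominator n + 1 also covers x = 0; minimality then reads 0 <= - t^2 (n / 2 + 1). *)
pose t := d / (n + 1).
have := le_trans Jy (mJ (y + t *: x)).
rewrite /J fD fZ !(dotDl, dotDr, dotZl, dotZr) (dotC y x) -/n => h.
have {}h : 0 <= t ^+ 2 * n / 2 - t * d by rewrite /d; lra.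
have dE : d = t * (n + 1) by rewrite /t divfK// lt0r_neq0.
rewrite dE in h *; have n0 : 0 <= n by exact: dot_ge0.
have t2 : t ^+ 2 <= 0 by have := sqr_ge0 t; nra.
by rewrite exprMn mulr_le0_ge0// sqr_ge0.
Qed.

(** Riesz representation makes the set in the choice defining [adjoint] nonempty; linearity then
    follows from the adjoint identity. *)
Lemma adjoint_exists (Y : preHilbertType R) (A : {linear X -> Y}) (nA : R) :
  (forall x, `|A x| <= nA * `|x|) ->
  exists2 As : {linear Y -> X}, adjoint A = As &
    forall x y, dot (A x) y = dot x (As y).
Proof.
move=> A_le.
have adjP y : exists z, forall x, dot (A x) y = dot x z.
  apply: (riesz_representation (M := nA * `|y|)).
  - by move=> x x'; rewrite linearD dotDl.
  - by move=> a x; rewrite linearZ dotZl.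
  - move=> x; apply: le_trans (normr_dot_le _ _) _.
    by rewrite mulrAC ler_wpM2r.
have [B BP] := choice adjP.
have adjE x y : dot (A x) y = dot x (adjoint A y).
  have : [set B | forall x y, dot (A x) y = dot x (B y)] (adjoint A).
    apply: (@xgetPex _ (fun=> 0)
      [set B | forall x y, dot (A x) y = dot x (B y)]).
    by exists B => x' y'.
  exact.
have lin : linear (adjoint A).
  move=> a y z; apply: dot_inj => x.
  by rewrite -adjE !(dotDr, dotZr) !adjE.
pose L := GRing.isLinear.Build R Y X *:%R (adjoint A) lin.
pose As : {linear Y -> X} := HB.pack (adjoint A) L.
by exists As.
Qed.

End riesz.

Lemma subdiff_quadratic (R : realType) (X : preHilbertType R) (a : R) (u xi : X) :
  0 < a -> subdiff (quadratic a) u xi <-> xi = a *: u.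
Proof.
move=> a0; split=> [[_ h]|->].
  (* The test point is a^-1 xi, the minimizer of the quadratic minus its proposed affine
     minorant. *)
  have := h (u + a^-1 *: (xi - a *: u)).
  rewrite /quadratic -EFinD lee_fin [u + _]addrC addrK !normr_sqr_dot.
  set e := xi - a *: u; have -> : xi = a *: u + e by rewrite /e subrKC.
  clearbody e; rewrite !(dotDl, dotDr, dotZl, dotZr) (dotC e u) => h1.
  have h2 : 0 <= - (a^-1 * dot e e / 2).
    move: h1; rewrite -subr_ge0; congr (_ <= _); field; exact: lt0r_neq0.
  have : dot e e <= 0.
    by rewrite -(pmulr_rle0 _ (_ : 0 < a^-1)) ?invr_gt0//; lra.
  move=> e0; have /dot_eq0 -> : dot e e = 0.
    by apply/eqP; rewrite eq_le e0 dot_ge0.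
  by rewrite addr0.
split=> // y; rewrite /quadratic -EFinD lee_fin !normr_sqr_dot.
rewrite dotZl dotBr; have := mulr_ge0 (ltW a0) (dot_ge0 (y - u)).
rewrite !(dotBl, dotBr) (dotC y u); lra.
Qed.

Section saddle_map.
Context {R : realType} {X Y : preHilbertType R}.
Variables (alpha : R) (F : Y -> \bar R) (K : X -> Y) (V : Y -> Y -> set Y).
Variables (uhat : X) (vhat : Y) (As : {linear Y -> X}).
Hypothesis alpha0 : 0 < alpha.
Hypothesis adjE : adjoint ('d K uhat) = As.
Hypothesis adj : forall x y, dot ('d K uhat x) y = dot x (As y).

Lemma saddle_map_rel :
  saddle_map (@quadratic R X alpha) F K uhat =
  saddle_rel (subdiff F) alpha ('d K uhat) As (K uhat - 'd K uhat uhat).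
Proof.
apply/funext => -[u v]; apply/seteqP; split => w /=.
  move=> [[xi /(subdiff_quadratic _ _ alpha0) xiE w1] [eta Feta w2]].
  split; first by rewrite w1 xiE adjE.
  by rewrite w2 [X in subdiff F v X](_ : _ = eta)//; dot_ring.
move=> [w1 w2]; split.
  by exists (alpha *: u); [exact/subdiff_quadratic|rewrite w1 adjE].
by eexists; first exact: w2; dot_ring.
Qed.

Local Notation B := (schur alpha ('d K uhat) As).

Lemma bbar_coercive (nA : R) : 0 < nA -> (forall x, `|'d K uhat x| <= nA * `|x|) ->
  (forall v eta, subdiff F v eta -> polar (V v eta) 0) ->
  (0 < bbar alpha F K V uhat vhat)%E ->
  exists kap t : R, [/\ 0 < kap, 0 < t & forall v eta, subdiff F v eta ->
    `|v - vhat| < t -> `|eta - K uhat| < t ->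
    coercive_on 0 B kap (V v eta)].
Proof.
move=> nA0 A_le pol /ereal_sup_gt[_ [t t0 <-]] /= ht.
have [k0 k00 hk] : exists2 k0 : R, 0 < k0 & forall p : Y * Y, p.1 != 0 ->
   (exists v' eta', [/\ V v' eta' p.1, polar (V v' eta') p.2, subdiff F v' eta',
            `|v' - vhat| < t & `|eta' - K uhat| < t]) ->
    k0 <= `|alpha^-1 *: 'd K uhat (adjoint ('d K uhat) p.1) - p.2| / `|p.1|.
  move: ht; set I := ereal_inf _ => I0.
  (* The infimum is +oo when no z is admissible; any positive bound then serves. *)
  have [k0 k00 k0I] : exists2 k0 : R, 0 < k0 & (k0%:E <= I)%E.
    case: I I0 => [r||] //; first by rewrite lte_fin => r0; exists r.
    by move=> _; exists 1 => //; exact: leey.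
  exists k0 => // p p1 hp; rewrite -lee_fin (le_trans k0I)//.
  by apply: ereal_inf_lbound; exists p.
(* Taking nu = 0 gives k0 |z| <= |B z| <= alpha^-1 nA |As z|, while <B z, z> = alpha^-1 |As z|^2. *)
pose kap := k0 ^+ 2 * alpha / nA ^+ 2.
have kap0 : 0 < kap by rewrite divr_gt0 ?mulr_gt0 ?exprn_gt0.
exists kap, t; split=> // v eta Fv vt et z Vz; rewrite mul0r addr0.
have [->|z0] := eqVneq z 0; first by rewrite normr0 expr0n mulr0 dot_schur_ge0.
have zp : 0 < `|z| by rewrite normr_gt0.
have := hk (z, 0) z0; case/(_ _)/wrap => [|].
  by exists v, eta; split => //; exact: pol.
rewrite /= subr0 adjE ler_pdivlMr// => h.
have h2 : k0 * `|z| <= alpha^-1 * nA * `|As z|.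
  apply: le_trans h _; rewrite normrZ gtr0_norm ?invr_gt0// -mulrA.
  by rewrite ler_pM2l ?invr_gt0.
rewrite dot_schur// -normr_sqr_dot.
have h3 : (k0 * `|z|) ^+ 2 <= (alpha^-1 * nA * `|As z|) ^+ 2.
  by rewrite ler_pXn2r// ?nnegrE ?mulr_ge0// ?ltW ?invr_gt0.
rewrite /kap mulrAC ler_pdivrMr ?exprn_gt0//.
move: h3; rewrite !exprMn => h3.
have := ler_wpM2l (ltW alpha0) h3.
have -> : alpha * (alpha^-1 ^+ 2 * nA ^+ 2 * `|As z| ^+ 2) =
    alpha^-1 * `|As z| ^+ 2 * nA ^+ 2 by field; rewrite lt0r_neq0.
by apply: le_trans; rewrite le_eqVlt; apply/orP; left; apply/eqP; ring.
Qed.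

(** Since <nu, z> <= 0, also <B z - nu, z> >= kap |z|^2, and Cauchy-Schwarz turns this into a bound
    on the quotient. *)
Lemma coercive_bbar (kap t : R) : 0 < kap -> 0 < t ->
  (forall v eta, subdiff F v eta -> `|v - vhat| < t -> `|eta - K uhat| < t ->
    coercive_on 0 B kap (V v eta)) ->
  (0 < bbar alpha F K V uhat vhat)%E.
Proof.
move=> kap0 t0 coer; rewrite /bbar; set I := (X in ereal_sup X).
apply: (@lt_le_trans _ _ kap%:E); first by rewrite lte_fin.
apply: le_trans (ereal_sup_ubound (_ : I _)); last by exists t.
apply/ereal_infP => _ [[z nu] /= [z0 [v [eta [Vz Vnu Fv vt et]]]] <-].
have zp : 0 < `|z| by rewrite normr_gt0.
rewrite lee_fin ler_pdivlMr// -(ler_pM2r zp) adjE.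
apply: le_trans (dot_le _ _); rewrite -mulrA -expr2.
have := coer _ _ Fv vt et _ Vz; rewrite mul0r addr0 => /le_trans; apply.
by rewrite dotBl lerDl oppr_ge0; exact: Vnu.
Qed.

End saddle_map.

(** * Pointwise proximal points *)

(** The nested sublevel sets of f in A generate a proper filter; lower semicontinuity places any of
    its cluster points in all of them. *)
Lemma lsc_compact_min (R : realType) (T : topologicalType) (f : T -> \bar R)
    (A : set T) :
  compact A -> A !=set0 -> lower_semicontinuous f ->
  exists2 x, A x & forall y, A y -> (f x <= f y)%E.
Proof.
move=> Ac [a0 Aa0] fl.
pose G := filter_from A (fun y => A `&` [set x | (f x <= f y)%E]).
have GF : ProperFilter G.
  apply: filter_from_proper; last by move=> y Ay; exists y; split => /=.
  apply: filter_from_filter; first by exists a0.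
  move=> i j Ai Aj; have [ij|/ltW ji] := leP (f i) (f j).
    by exists i => // x [Ax xi]; split; split => //; exact: le_trans xi ij.
  by exists j => // x [Ax xj]; split; split => //; exact: le_trans xj ji.
have GA : G A by exists a0 => // x [].
have [x [Ax Gx]] := Ac G GF GA; exists x => // y Ay.
rewrite leNgt; apply/negP => yx.
have [a ya ax] : exists2 a, (f y <= a%:E)%E & (a%:E < f x)%E.
  case: (f y) yx => [r||] yx; first by exists r.
    by rewrite ltNge leey in yx.
  case: (f x) yx => [r||] // _; last by exists 0; rewrite ?leNye ?ltry.
  by exists (r - 1); rewrite ?leNye// lte_fin ltrBlDr ltrDl.
have [U xU Ua] := fl _ _ ax.
have [z [[_ zy] Uz]] : (A `&` [set x | (f x <= f y)%E]) `&` U !=set0.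
  by apply: Gx => //; exists y.
by have := lt_le_trans (Ua _ Uz) (le_trans zy ya); rewrite ltxx.
Qed.

Section row_norms.
Context {R : realType} {m : nat}.
Implicit Types x y : 'rV[R]_m.

Lemma row_coord_le_norm x i : `|x 0 i| <= `|x|.
Proof.
rewrite [leRHS]mx_normrE.
exact: (@le_bigmax _ _ _ _ (fun ij : 'I_1 * 'I_m => `|x ij.1 ij.2|) (0, i)).
Qed.

Lemma row_norm_le_dot x : `|x| <= dot_norm x.
Proof.
rewrite [leLHS]mx_normrE; apply/bigmax_leP; split; first exact: sqrtr_ge0.
move=> [i j] _ /=; rewrite (ord1 i) -sqrtr_sqr ler_wsqrtr//.
rewrite /dot /= /row_dot (bigD1 j)//= -expr2 lerDl.
by apply: sumr_ge0 => k _; rewrite -expr2 sqr_ge0.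
Qed.

Lemma row_dot_le_norm x : dot_norm x <= m%:R * `|x|.
Proof.
rewrite -(@ler_pXn2r _ 2) ?nnegrE ?mulr_ge0 ?sqrtr_ge0//.
rewrite sqr_sqrtr ?dot_ge0// exprMn.
apply: (@le_trans _ _ (m%:R * `|x| ^+ 2)).
  have -> : m%:R * `|x| ^+ 2 = \sum_(i < m) `|x| ^+ 2.
    by rewrite sumr_const card_ord mulr_natl.
  apply: ler_sum => i _; rewrite -expr2 -real_normK ?num_real//.
  by rewrite ler_pXn2r ?nnegrE// row_coord_le_norm.
rewrite ler_wpM2r ?sqr_ge0// -natrX ler_nat.
by case: (m) => // k; rewrite -{1}[k.+1]expn1 leq_pexp2l.
Qed.

Lemma row_closed_ball_compact x (r : R) : compact [set y | `|y - x| <= r].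
Proof.
apply: bounded_closed_compact.
  exists (r + `|x|); split; first exact: num_real.
  move=> c rc y /= yx; apply: le_trans (ltW rc).
  by rewrite -[y](subrK x) (le_trans (ler_normD _ _))// lerD2r.
rewrite [X in closed X](_ : _ = (fun y => `|y - x|) @^-1` [set t | t <= r])//.
apply: preimage_closed; last exact: closed_le.
move=> y _; apply: (@cvg_norm _ _ _ (nbhs y) _ (fun y => y - x)).
apply: cvgB; [exact: cvg_id|exact: cvg_cst].
Qed.

Lemma row_cvg_dot (T : Type) (F : set_system T) (FF : Filter F)
    (u v : T -> 'rV[R]_m) x y :
  u @ F --> x -> v @ F --> y -> (fun t => dot (u t) (v t)) @ F --> dot x y.
Proof.
move=> ux vy; rewrite /dot /= /row_dot.
apply: cvg_big => [|i _]; first exact: add_continuous.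
apply: cvgM.
  by apply: (cvg_comp u (fun M : 'rV[R]_m => M 0 i) ux); exact: coord_continuous.
by apply: (cvg_comp v (fun M : 'rV[R]_m => M 0 i) vy); exact: coord_continuous.
Qed.

End row_norms.

Lemma subdiff_monotone (R : realType) (E : innerProductType R) (f : E -> \bar R)
    (x y xi eta : E) :
  subdiff f x xi -> subdiff f y eta -> 0 <= dot (xi - eta) (x - y).
Proof.
move=> [fx /(_ y) hx] [fy /(_ x) hy].
move: fx fy hx hy; case: (f x) => [a||] //; case: (f y) => [b||] // _ _.
rewrite -!EFinD !lee_fin !(dotBl, dotBr); lra.
Qed.

Section proximal_point.
Context {R : realType} {m : nat}.
Implicit Types x y p s : 'rV[R]_m.
Variable f : 'rV[R]_m -> \bar R.
Hypothesis fproper : proper_fun f.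
Hypothesis fconvex : econvex f.
Hypothesis flsc : lower_semicontinuous f.

Let quad (a : R) s y : R := a / 2 * dot y y - dot s y.

Let quad_continuous a s : continuous (quad a s).
Proof.
move=> y.
have h1 : (fun z : 'rV[R]_m => dot z z) @ y --> dot y y.
  by apply: (@row_cvg_dot _ _ _ (nbhs y) _ id id); exact: cvg_id.
have h2 : (fun z : 'rV[R]_m => dot s z) @ y --> dot s y.
  by apply: (@row_cvg_dot _ _ _ (nbhs y) _ (cst s) id); [exact: cvg_cst|exact: cvg_id].
rewrite /continuous_at /quad.
apply: (@cvgB _ _ _ _ _ (fun z : 'rV[R]_m => a / 2 * dot z z) _ _ _ _ h2).
by apply: cvgM; [exact: cvg_cst|].
Qed.

Lemma lsc_quad a s : lower_semicontinuous (fun y => f y + (quad a s y)%:E)%E.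
Proof.
move=> x c cx.
have [e e0 he] : exists2 e : R, 0 < e & ((c - quad a s x + e)%:E < f x)%E.
  case: (f x) cx => [r||] //.
    rewrite -EFinD lte_fin => h; exists ((r + quad a s x - c) / 2).
      by rewrite divr_gt0// subr_gt0.
    by rewrite lte_fin; lra.
  by move=> _; exists 1 => //; exact: ltry.
have [U xU hU] := flsc he.
have Q : nbhs x [set y | quad a s x - e < quad a s y].
  by apply: (cvgr_gt (quad a s x) (@quad_continuous a s x)); rewrite ltrBlDr ltrDl.
exists (U `&` [set y | quad a s x - e < quad a s y]); first exact: filterI.
move=> y [/hU hy hq]; move: hy; case: (f y) => [r||] //.
  by rewrite -EFinD !lte_fin; move: hq => /=; lra.
by move=> _; rewrite addye// ltry.
Qed.

Let quad_segment a s x y t :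
  quad a s (t *: y + (1 - t) *: x) = t * quad a s y + (1 - t) * quad a s x
    - a / 2 * (t * (1 - t)) * dot (y - x) (y - x).
Proof.
rewrite /quad !(dotDl, dotDr, dotNl, dotNr, dotZl, dotZr) (dotC y x); ring.
Qed.

Lemma convex_segment x y (t u v : R) : 0 <= t <= 1 -> f x = u%:E -> f y = v%:E ->
  exists2 w, f (t *: y + (1 - t) *: x) = w%:E & w <= t * v + (1 - t) * u.
Proof.
move=> t01 fx fy; have := fconvex y x t01; rewrite fx fy -!EFinM -EFinD.
have := fproper.1 (t *: y + (1 - t) *: x); case: (f _) => [w||] // _.
by rewrite lee_fin; exists w.
Qed.

Lemma proximal_minimizer a s : 0 < a -> exists2 p, f p \is a fin_num &
  forall y, (f p + (quad a s p)%:E <= f y + (quad a s y)%:E)%E.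
Proof.
move=> a0; pose g y := (f y + (quad a s y)%:E)%E.
have [x0 fx0] := fproper.2.
have [u0 u0E] : exists u0, f x0 = u0%:E.
  by have := fproper.1 x0; case: (f x0) fx0 => [r||] // _ _; exists r.
have minball r : 0 <= r -> exists p, [/\ `|p - x0| <= r, f p \is a fin_num &
    forall y, `|y - x0| <= r -> (g p <= g y)%E].
  move=> r0.
  have [|p px0 hp] :=
    lsc_compact_min (@row_closed_ball_compact _ _ x0 r) _ (@lsc_quad a s).
    by exists x0; rewrite /= subrr normr0.
  exists p; split => //.
  have := hp x0; rewrite /= subrr normr0 u0E => /(_ r0).
  by have := fproper.1 p; case: (f p) => [q||].
have [p1 [_ fp1 hp1]] := minball 1 ler01.
have [u1 u1E] : exists u1, f p1 = u1%:E.
  by move: fp1; case: (f p1) => [r||] // _; exists r.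
pose g0 := u0 + quad a s x0; pose M := u1 + quad a s p1.
have Mg0 : M <= g0.
  by have := hp1 x0; rewrite /g subrr normr0 u0E u1E -!EFinD lee_fin; exact.
(* At sup-norm distance rho from x0 the strong convexity gain is a (rho - 1) / 2; from rho >= r on
   it exceeds g0 - M, so y cannot beat x0. *)
pose r := 1 + 2 * (g0 - M) / a.
have r1 : 1 <= r by rewrite lerDl divr_ge0 ?(ltW a0)// mulr_ge0// subr_ge0.
have [p [px fp hp]] := minball r (le_trans ler01 r1).
exists p => // y; have [/hp//|yr] := leP `|y - x0| r.
have [fyoo|fyoo] := eqVneq (f y) +oo%E.
  by rewrite fyoo addye// leey.
have [v vE] : exists v, f y = v%:E.
  by have := fproper.1 y; case: (f y) fyoo => [q||] // _ _; exists q.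
apply: le_trans (hp x0 _) _; first by rewrite subrr normr0 (le_trans ler01).
rewrite /g u0E vE -!EFinD lee_fin -/g0.
set rho := `|y - x0| in yr.
have rho1 : 1 < rho by exact: le_lt_trans yr.
have rho0 : 0 < rho by exact: lt_trans rho1.
pose t := rho^-1.
have t01 : 0 <= t <= 1 by rewrite invr_ge0 ltW//= invf_le1// ltW.
have [w wE wle] := convex_segment t01 u0E vE.
have := hp1 (t *: y + (1 - t) *: x0).
have -> : t *: y + (1 - t) *: x0 - x0 = t *: (y - x0) by dot_ring.
rewrite normrZ -/rho gtr0_norm ?invr_gt0// mulVf ?lt0r_neq0// => /(_ (lexx _)).
rewrite /g u1E wE -!EFinD lee_fin quad_segment -/M => h.
have d : rho ^+ 2 <= dot (y - x0) (y - x0).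
  rewrite -(sqr_sqrtr (dot_ge0 _)) ler_pXn2r ?nnegrE ?sqrtr_ge0 ?normr_ge0//.
  exact: row_norm_le_dot.
have hM : M <= t * (v + quad a s y) + (1 - t) * g0
    - a / 2 * (t * (1 - t)) * dot (y - x0) (y - x0) by rewrite /g0; lra.
have tr : t * rho = 1 by rewrite mulVf// lt0r_neq0.
have := t01; move=> /andP[tg0 t1].
have h2 : a / 2 * (t * (1 - t)) * rho ^+ 2 <=
    a / 2 * (t * (1 - t)) * dot (y - x0) (y - x0).
  apply: ler_wpM2l => //; apply: mulr_ge0; first by rewrite divr_ge0 ?(ltW a0).
  by apply: mulr_ge0 => //; rewrite subr_ge0.
have h3 : a / 2 * (t * (1 - t)) * rho ^+ 2 = a / 2 * (rho - 1).
  have -> : a / 2 * (t * (1 - t)) * rho ^+ 2 =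
     a / 2 * (t * rho) * (rho - t * rho) by ring.
  by rewrite tr mulr1.
have h4 : g0 - M <= a / 2 * (rho - 1).
  have : r <= rho by exact: ltW.
  rewrite /r -lerBrDl ler_pdivrMr//; lra.
have h5 : 0 <= t * (v + quad a s y - g0) by rewrite h3 in h2; lra.
by move: h5; rewrite pmulr_rge0 ?invr_gt0// subr_ge0.
Qed.

Lemma proximal_point a s : 0 < a -> exists p, subdiff f p (s - a *: p).
Proof.
move=> a0; have [p fp hp] := proximal_minimizer s a0; exists p; split => // y.
have [u uE] : exists u, f p = u%:E by move: fp; case: (f p) => [r||] // _; exists r.
have [fyoo|fyoo] := eqVneq (f y) +oo%E; first by rewrite fyoo leey.
have [v vE] : exists v, f y = v%:E.
  by have := fproper.1 y; case: (f y) fyoo => [q||] // _ _; exists q.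
rewrite uE vE -EFinD lee_fin.
(* Comparing p with the point at parameter t on the segment to y and dividing by t leaves an error
   linear in t. *)
suff H t : 0 < t -> t <= 1 ->
    u + dot (s - a *: p) (y - p) <= v + t * (a / 2 * dot (y - p) (y - p)).
  apply/ler_addgt0Pr => e e0.
  set n := a / 2 * dot (y - p) (y - p) in H.
  have n0 : 0 <= n by rewrite mulr_ge0 ?dot_ge0// divr_ge0// ltW.
  pose t := e / (n + e).
  have ne : 0 < n + e by rewrite ltr_wpDl.
  apply: le_trans (H t _ _) _.
  - by rewrite divr_gt0.
  - by rewrite ler_pdivrMr// mul1r lerDr.
  - by rewrite lerD2l /t mulrAC ler_pdivrMr// ler_pM2l// lerDl ltW.
move=> t0 t1.
have t01 : 0 <= t <= 1 by rewrite ltW.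
have [w wE wle] := convex_segment t01 uE vE.
have := hp (t *: y + (1 - t) *: p); rewrite uE wE -!EFinD lee_fin quad_segment.
move=> h; rewrite -(ler_pM2l t0); move: h.
by rewrite /quad !(dotDl, dotDr, dotNl, dotNr, dotZl, dotZr) (dotC y p); lra.
Qed.

End proximal_point.

(** The inverse of the subdifferential of f plus a times the identity. With a = 1 + gamma it is the
    resolvent for f + gamma/2 |.|^2, so the regularization is absorbed into a. *)
Definition prox (R : realType) (m : nat) (f : 'rV[R]_m -> \bar R) (a : R)
  (s : 'rV[R]_m) : 'rV[R]_m := xget 0 [set p | subdiff f p (s - a *: p)].

Lemma cvgn_at_right (R : realType) (T : topologicalType) (g : R -> T) (l : T) :
  g @ 0^'+ --> l -> (fun k : nat => g k.+1%:R^-1) @ \oo --> l.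
Proof.
move=> gl; apply: cvg_comp gl => A A0.
have hA : \forall x \near (0 : R), 0 < x -> A x by exact: A0.
have h : \oo (harmonic @^-1` (fun x : R => 0 < x -> A x)) := @cvg_harmonic R _ hA.
by apply: filterS h => k /=; apply; rewrite invr_gt0.
Qed.

Section prox.
Context {R : realType} {m : nat}.
Variables (f : 'rV[R]_m -> \bar R) (a : R).
Hypothesis fproper : proper_fun f.
Hypothesis fconvex : econvex f.
Hypothesis flsc : lower_semicontinuous f.
Hypothesis a1 : 1 <= a.
Local Notation P := (prox f a).

Let a0 : 0 < a. Proof. exact: lt_le_trans a1. Qed.

Lemma proxP s : subdiff f (P s) (s - a *: P s).
Proof.
have := proximal_point fproper fconvex flsc s a0.
exact: xgetPex.
Qed.

Lemma prox_monotone s t : a * dot (P s - P t) (P s - P t) <= dot (s - t) (P s - P t).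
Proof.
have := subdiff_monotone (proxP s) (proxP t).
have -> : s - a *: P s - (t - a *: P t) = (s - t) - a *: (P s - P t) by dot_ring.
by rewrite [leRHS]dotBl dotZl subr_ge0.
Qed.

Lemma prox_unique p xi : subdiff f p xi -> p = P (xi + a *: p).
Proof.
move=> fp; set s := xi + a *: p.
have := subdiff_monotone fp (proxP s).
have -> : xi - (s - a *: P s) = - (a *: (p - P s)) by rewrite /s; dot_ring.
rewrite dotNl dotZl oppr_ge0 pmulr_rle0// => h.
apply/eqP; rewrite -subr_eq0; apply/eqP/dot_eq0/eqP.
by rewrite eq_le h dot_ge0.
Qed.

Lemma prox_dot_lip s t : dot (P s - P t) (P s - P t) <= dot (s - t) (s - t).
Proof.
have : dot (P s - P t) (P s - P t) <= dot (s - t) (P s - P t).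
  by apply: le_trans (prox_monotone s t); rewrite ler_peMl ?dot_ge0.
move: (P s - P t) (s - t) => d e h1.
have h2 := dot_ge0 (e - d); rewrite !(dotBl, dotBr) (dotC d e) in h2; lra.
Qed.

Lemma prox_lip s t : dot_norm (P s - P t) <= dot_norm (s - t).
Proof. by rewrite ler_wsqrtr// prox_dot_lip. Qed.

Lemma prox_continuous : continuous P.
Proof.
apply: (@lip_continuous _ _ _ _ m%:R) => s t.
by rewrite (le_trans (row_norm_le_dot _))// (le_trans (prox_lip _ _))// row_dot_le_norm.
Qed.

Hypothesis fproto : proto_differentiable (subdiff f).

Let quot s d (k : nat) := k.+1%:R *: (P (s + k.+1%:R^-1 *: d) - P s).

Lemma quotient_dot_le s d k : dot_norm (quot s d k) <= dot_norm d.
Proof.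
rewrite /quot dot_normZ gtr0_norm// mulrC -ler_pdivlMr// mulrC.
apply: le_trans (prox_lip _ _) _.
rewrite [s + _]addrC addrK dot_normZ gtr0_norm// invr_gt0//.
Qed.

(* A cluster point of the difference quotients is a tangent direction; geometric
   derivability supplies a curve with that direction, and prox, being Lipschitz,
   follows it. *)
Lemma prox_dir_deriv s d : exists z, dir_deriv P s d z.
Proof.
pose u := quot s d.
have [z [_ uz]] : [set y | `|y - 0| <= dot_norm d] `&` cluster (u @ \oo) !=set0.
  apply: (@row_closed_ball_compact _ _ 0 (dot_norm d)).
  exists 0%N => // k _; rewrite /= subr0.
  exact: le_trans (row_norm_le_dot _) (quotient_dot_le _ _ _).
have kP (n : nat) : exists k, (n <= k)%N /\ `|u k - z| < n.+1%:R^-1.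
  have n0 : 0 < n.+1%:R^-1 :> R by rewrite invr_gt0.
  have [_ [[k nk <-] h]] : [set u k | k in [set k | (n <= k)%N]] `&`
      [set y | `|y - z| < n.+1%:R^-1] !=set0.
    apply: uz; first by exists n => // k nk; exists k.
    have := nbhsx_ballx z _ n0; apply: filterS => y.
    by rewrite -ball_normE /= distrC.
  by exists k.
have [ka kaP] := choice kP.
have uka : (fun n => u (ka n)) @ \oo --> z.
  apply/subr_cvg0/norm_cvg0P.
  apply: (squeeze_cvgr _ (@cvg_cst _ _ _ _ _) (@cvg_harmonic R)).
  by apply: nearW => n; rewrite normr_ge0 /= ltW//; exact: (kaP n).2.
pose eta := s - a *: P s.
have tgt : tangent (graph (subdiff f)) (P s, eta) (z, d - a *: z).
  exists (fun n => (ka n).+1%:R^-1).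
  pose sn n := s + (ka n).+1%:R^-1 *: d.
  exists (fun n => (P (sn n), sn n - a *: P (sn n))); split.
  - by move=> n; rewrite invr_gt0.
  - apply: (squeeze_cvgr _ (@cvg_cst _ _ _ _ _) (@cvg_harmonic R)).
    apply: nearW => n; rewrite invr_ge0 ler0n /=.
    by rewrite lef_pV2 ?posrE// ler_nat ltnS (kaP n).1.
  - by move=> n; exact: proxP.
  have -> : (fun n => ((ka n).+1%:R^-1)^-1 *:
       ((P (sn n), sn n - a *: P (sn n)) - (P s, eta))) =
     (fun n => (u (ka n), d - a *: u (ka n))).
    apply/funext => n; rewrite invrK; congr pair => /=.
    rewrite /u /quot /eta -/(sn n).
    move: (P (sn n)) => q; rewrite /sn; dot_field.
    by rewrite addrC natr1 pnatr_eq0.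
  apply: cvgn_pair => //; apply: cvgB; first exact: cvg_cst.
  by apply: cvgZ; first exact: cvg_cst.
have [e [xi [e0 gxi xi0 xiz]]] := fproto (proxP s : graph (subdiff f) (P s, eta)) tgt.
have xizn := cvgn_at_right xiz.
set w := (fun k : nat => _) in xizn.
have w1 : (fun k => (w k).1) @ \oo --> z by exact: cvgn_fst xizn.
have w2 : (fun k => (w k).2) @ \oo --> d - a *: z by exact: cvgn_snd xizn.
exists z.
(* A point of the curve is the proximal point of its own sum xi_2 + a xi_1, so nonexpansiveness
   compares the curve with P (s + h d); m is the price of passing between the norms. *)
have main : \forall k \near \oo,
   `|u k - (w k).1| <= m%:R * `|d - (w k).2 - a *: (w k).1|.
  near=> k.
  have he : k.+1%:R^-1 <= e by apply/ltW; near: k; exact: near_harmonic_lt.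
  set h := k.+1%:R^-1 in he.
  have h0 : 0 < h by rewrite invr_gt0.
  have := gxi h; rewrite ltW//= => /(_ he) gh.
  have xh : (xi h).1 = P ((xi h).2 + a *: (xi h).1) by exact: prox_unique.
  apply: le_trans (row_norm_le_dot _) _; apply: le_trans (row_dot_le_norm _).
  have -> : u k - (w k).1 = k.+1%:R *: (P (s + h *: d) - P ((xi h).2 + a *: (xi h).1)).
    rewrite -xh /u /quot /w -/h xi0 /= invrK.
    by move: (P _) => q; dot_ring.
  have -> : d - (w k).2 - a *: (w k).1 =
      k.+1%:R *: (s + h *: d - ((xi h).2 + a *: (xi h).1)).
    rewrite /w -/h xi0 /= invrK /eta /h; dot_field.
    by rewrite addrC natr1 pnatr_eq0.
  by rewrite !dot_normZ ler_wpM2l// prox_lip.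
have lim : (fun k => m%:R * `|d - (w k).2 - a *: (w k).1|) @ \oo -->
    m%:R * `|d - (d - a *: z) - a *: z|.
  apply: cvgM; first exact: cvg_cst.
  apply: cvg_norm; apply: cvgB; last by apply: cvgZ; first exact: cvg_cst.
  by apply: cvgB; first exact: cvg_cst.
have zero : d - (d - a *: z) - a *: z = 0 by dot_ring.
rewrite zero normr0 mulr0 in lim.
exact: cvgn_near w1 lim main.
Unshelve. all: by end_near. Qed.

End prox.

(** * Square-integrable functions *)

Lemma aeI d (T : measurableType d) (R : realType) (mu : {measure set T -> \bar R})
    (A B : T -> Prop) :
  {ae mu, forall x, A x} -> {ae mu, forall x, B x} ->
  {ae mu, forall x, A x /\ B x}.
Proof. by move=> hA hB; apply: filterS2 hA hB. Qed.

Lemma ae_eq_integrable d (T : measurableType d) (R : realType)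
    (mu : {measure set T -> \bar R}) (f g : T -> \bar R) :
  measurable_fun setT g -> ae_eq mu setT f g ->
  mu.-integrable setT f -> mu.-integrable setT g.
Proof.
move=> mg fg /integrableP[mf fi]; apply/integrableP; split => //.
rewrite -(@ae_eq_integral _ _ _ mu setT (fun x => `|g x|%E) (fun x => `|f x|%E))//.
- exact: measurableT_comp.
- exact: measurableT_comp.
- by apply: filterS fg => x /(_ I) -> _.
Qed.

Section L2_functions.
Context d (T : measurableType d) (R : realType).
Variables (mu : {measure set T -> \bar R}) (m : nat).
Implicit Types f g : T -> 'rV[R]_m.

Definition coord_measurable f :=
  forall i, measurable_fun [set: T] (fun x => f x 0 i).

Lemma L2_coord_measurable (f : L2 mu m) : coord_measurable f.
Proof.
by move=> i; have := L2_coord f i; rewrite inE => /andP[+ _]; rewrite inE.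
Qed.

Lemma coord_measurableD f g : coord_measurable f -> coord_measurable g ->
  coord_measurable (fun x => f x + g x).
Proof.
move=> mf mg i; under eq_fun do rewrite mxE.
exact: measurable_funD.
Qed.

Lemma coord_measurableZ (h : T -> R) f :
  measurable_fun [set: T] h -> coord_measurable f ->
  coord_measurable (fun x => h x *: f x).
Proof.
move=> mh mf i; under eq_fun do rewrite mxE.
exact: measurable_funM.
Qed.

Lemma coord_measurableB f g : coord_measurable f -> coord_measurable g ->
  coord_measurable (fun x => f x - g x).
Proof.
move=> mf mg i; under eq_fun do rewrite !mxE.
exact: measurable_funB.
Qed.

Lemma coord_measurable_dot f g : coord_measurable f -> coord_measurable g ->
  measurable_fun [set: T] (fun x => dot (f x) (g x)).
Proof.
move=> mf mg; rewrite /dot /= /row_dot.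
by apply: measurable_sum => i; exact: measurable_funM.
Qed.

Lemma Lfun2P (h : T -> R) : measurable_fun [set: T] h ->
  (\int[mu]_x (h x ^+ 2)%:E < +oo)%E -> h \in Lfun mu 2%:E.
Proof.
move=> mh hoo; rewrite inE; apply/andP; split; rewrite inE//=.
rewrite /finite_norm unlock /=; apply: poweR_lty.
apply: le_lt_trans hoo; rewrite le_eqVlt; apply/orP; left; apply/eqP.
apply: eq_integral => x _.
by rewrite /= powR_mulrn// real_normK// num_real.
Qed.

Lemma l2fun_dot f : coord_measurable f ->
  (\int[mu]_x (dot (f x) (f x))%:E < +oo)%E -> f \in @l2fun _ T R mu m.
Proof.
move=> mf foo; apply/l2funP => i; apply: Lfun2P; first exact: mf.
apply: le_lt_trans foo; apply: ge0_le_integral => //.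
- by move=> x _; rewrite lee_fin sqr_ge0.
- by apply/measurable_EFinP; apply: measurable_funX; exact: mf.
- by apply/measurable_EFinP; exact: coord_measurable_dot.
move=> x _; rewrite lee_fin /dot /= /row_dot (bigD1 i)//= -expr2 lerDl.
by apply: sumr_ge0 => j _; rewrite -expr2 sqr_ge0.
Qed.

Lemma L2_lift f : coord_measurable f ->
  (\int[mu]_x (dot (f x) (f x))%:E < +oo)%E ->
  exists F : L2 mu m, ae_eq mu setT F f.
Proof.
move=> mf foo; exists (\pi_(L2 mu m)%qT (MkL2fun (l2fun_dot mf foo))).
exact: L2_reprK.
Qed.

Lemma ae_eq_int_dot f g : coord_measurable f -> coord_measurable g ->
  ae_eq mu setT f g ->
  (\int[mu]_x (dot (f x) (f x))%:E = \int[mu]_x (dot (g x) (g x))%:E)%E.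
Proof.
move=> mf mg fg; apply: ae_eq_integral => //.
- by apply/measurable_EFinP; exact: coord_measurable_dot.
- by apply/measurable_EFinP; exact: coord_measurable_dot.
- by apply: filterS fg => x /(_ I) + _ => ->.
Qed.

Lemma L2_norm_int (F : L2 mu m) :
  (`|F| ^+ 2)%:E = (\int[mu]_x (dot (F x) (F x))%:E)%E.
Proof.
rewrite normr_sqr_dot {1}/dot /= /L2_dot /Rintegral fineK//.
exact: integrable_fin_num (L2_dot_integrable F F).
Qed.

Lemma L2_norm_ae (F : L2 mu m) f : coord_measurable f -> ae_eq mu setT F f ->
  (`|F| ^+ 2)%:E = (\int[mu]_x (dot (f x) (f x))%:E)%E.
Proof.
move=> mf Ff; rewrite L2_norm_int; apply: ae_eq_int_dot => //.
exact: L2_coord_measurable.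
Qed.

Lemma L2_funB (F G : L2 mu m) : ae_eq mu setT (F - G : L2 mu m) (fun x => F x - G x).
Proof.
have h1 := L2_funD F (- G); have h2 := L2_funZ (-1) G.
apply: filterS2 h1 h2 => x + + _ => /(_ I) h /(_ I); rewrite scaleN1r => h'.
by rewrite h h' scaleN1r.
Qed.

Lemma L2_dot_ae (F G : L2 mu m) f g : coord_measurable f -> coord_measurable g ->
  ae_eq mu setT F f -> ae_eq mu setT G g ->
  mu.-integrable setT (fun x => (dot (f x) (g x))%:E) /\
  (dot F G)%:E = (\int[mu]_x (dot (f x) (g x))%:E)%E.
Proof.
move=> mf mg Ff Gg.
have FG := L2_dot_integrable F G.
have mFG : measurable_fun setT (fun x => (dot (F x) (G x))%:E).
  by have /measurable_int := FG.
have mfg : measurable_fun setT (fun x => (dot (f x) (g x))%:E).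
  by apply/measurable_EFinP; exact: coord_measurable_dot.
have ae : ae_eq mu setT (fun x => (dot (F x) (G x))%:E) (fun x => (dot (f x) (g x))%:E).
  by apply: filterS2 Ff Gg => x + + _ => /(_ I) -> /(_ I) ->.
split; first exact: ae_eq_integrable mfg ae FG.
rewrite -(@ae_eq_integral _ _ _ mu setT _ _ measurableT mFG mfg ae).
by rewrite {1}/dot /= /L2_dot /Rintegral fineK//; exact: integrable_fin_num FG.
Qed.

End L2_functions.

Section L2_complete.
Context d (T : measurableType d) (R : realType).
Variables (mu : {measure set T -> \bar R}) (m : nat).

Lemma coord_cvg_dot (u : nat -> 'rV[R]_m) (g y : 'rV[R]_m) :
  (forall i, (fun k => u k 0 i) @ \oo --> g 0 i) ->
  (fun k => dot (u k - y) (u k - y)) @ \oo --> dot (g - y) (g - y).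
Proof.
move=> ug; rewrite /dot /= /row_dot.
apply: cvg_big => [|i _]; first exact: add_continuous.
have h : (fun k => (u k - y) 0 i) @ \oo --> (g - y) 0 i.
  under eq_fun do rewrite !mxE.
  by rewrite !mxE; apply: cvgB; [exact: ug|exact: cvg_cst].
exact: cvgM.
Qed.

Lemma summable_increments_cvg (u : nat -> R) (C : R) : 0 <= C ->
  (forall k, `|u k.+1 - u k| <= C * (2^-1) ^+ k.+1) -> cvgn u.
Proof.
move=> C0 uC.
have h : cvgn (series (telescope u)).
  apply: normed_cvg; apply: (@series_le_cvg _ _ (geometric (C / 2) 2^-1)) => [k|k|k|].
  - exact: normr_ge0.
  - by rewrite /geometric /= mulr_ge0 ?exprn_ge0// divr_ge0.
  - by rewrite /geometric /= -mulrA -exprS; exact: uC.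
  - by apply: is_cvg_geometric_series; rewrite ger0_norm// invf_lt1 ?ltr1n.
have -> : u = (fun k => series (telescope u) k + u 0%N).
  by apply/funext => k; rewrite telescopeK /= subrK.
by apply: is_cvgD => //; exact: is_cvg_cst.
Qed.

(* Along a fast subsequence the weighted sum of the squared increments is
   integrable, so the subsequence converges almost everywhere. *)
Lemma L2_seq_complete : seq_complete (L2 mu m).
Proof.
move=> u uC.
(* The rate 4^-k and the weight 8^k balance: 8^k (4^-k)^2 = 2^-k is summable, and where the weighted
   sum is finite the increments are of order 2^-k. *)
pose e (k : nat) : R := (4^-1) ^+ k.+1.
have e0 k : 0 < e k by rewrite exprn_gt0.
have [N HN] := choice (fun k => uC (e k) (e0 k)).
(* Summing makes the index at least N k for every earlier k, so v j stays within e k of v k for j >=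
   k. *)
pose n k := (\sum_(j < k.+1) N j)%N.
have Nn k j : (k <= j)%N -> (N k <= n j)%N.
  move=> kj; rewrite /n (bigD1 (Ordinal (kj : (k < j.+1)%N)))//=; exact: leq_addr.
pose v k : L2 mu m := u (n k).
have vk k i : (N k <= i)%N -> `|u i - v k| <= e k.
  by move=> Ni; apply: HN => //; exact: Nn.
have vjk j k : `|v (j + k)%N - v k| <= e k by apply: vk; apply: Nn; exact: leq_addl.
have mv k : coord_measurable (v k) by exact: L2_coord_measurable.
pose D k x := v k.+1 x - v k x.
have mD k : coord_measurable (D k) by exact: coord_measurableB.
have mDD k : measurable_fun setT (fun x => (8 ^+ k.+1 * dot (D k x) (D k x))%:E).
  apply/measurable_EFinP; apply: measurable_funM => //.
  exact: coord_measurable_dot.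
have DD0 k x : 0 <= 8 ^+ k.+1 * dot (D k x) (D k x).
  by rewrite mulr_ge0 ?exprn_ge0// dot_ge0.
pose G x := (\sum_(0 <= k <oo) (8 ^+ k.+1 * dot (D k x) (D k x))%:E)%E.
have mG : measurable_fun setT G.
  apply: ge0_emeasurable_sum => [k x _ _|k _]; last exact: mDD.
  by rewrite lee_fin; exact: DD0.
have intD k : (\int[mu]_x (8 ^+ k.+1 * dot (D k x) (D k x))%:E <=
    0 + ((1 : R) / (2 ^ k.+1)%:R)%:E)%E.
  rewrite add0e; under eq_integral do rewrite EFinM.
  have mk : measurable_fun setT (fun x => (dot (D k x) (D k x))%:E).
    by apply/measurable_EFinP; exact: coord_measurable_dot.
  have dk0 x : [set: T] x -> (0 <= (dot (D k x) (D k x))%:E)%E.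
    by rewrite lee_fin dot_ge0.
  have c0 : (0 <= (8 ^+ k.+1 : R)%:E)%E by rewrite lee_fin exprn_ge0.
  rewrite (ge0_integralZl mu measurableT mk dk0 c0).
  rewrite -(L2_norm_ae (mD k) (L2_funB (v k.+1) (v k))) -EFinM lee_fin.
  have h : `|v k.+1 - v k| ^+ 2 <= e k ^+ 2.
    by rewrite ler_pXn2r ?nnegrE ?(ltW (e0 k))//; exact: (vjk 1%N).
  apply: le_trans (ler_wpM2l _ h) _; first by rewrite exprn_ge0.
  rewrite natrX div1r /e -exprM mulnC exprM -exprMn -exprVn.
  by rewrite le_eqVlt; apply/orP; left; apply/eqP; congr (_ ^+ _); field.
have G0 x : (0 <= G x)%E by apply: nneseries_ge0 => k _ _; rewrite lee_fin.
have Gint : mu.-integrable setT G.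
  apply/integrableP; split => //.
  under eq_integral do rewrite gee0_abs//.
  rewrite /G integral_nneseries//; last by move=> k x _; rewrite lee_fin.
  apply: le_lt_trans (lee_nneseries _ (fun k _ => intD k)) _.
    by move=> k _ _; apply: integral_ge0 => x _; rewrite lee_fin.
  apply: le_lt_trans (epsilon_trick _ _ _) _ => //.
  by rewrite eseries0// add0e ltry.
pose E := [set x | (G x < +oo)%E].
have mE : measurable E.
  by rewrite -[E]setTI; exact: emeasurable_fun_infty_o.
have aeE : {ae mu, forall x, E x}.
  have := integrable_ae measurableT Gint; apply: filterS => x /(_ I).
  by rewrite ge0_fin_numE.
(* Cutting off outside E gives convergence at every point, hence a measurable limit. *)
pose w k x := \1_E x *: v k x.
have mw k : coord_measurable (w k) by apply: coord_measurableZ.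
have wv k : ae_eq mu setT (w k) (v k).
  by apply: filterS aeE => x Ex _; rewrite /w indicE mem_set// scale1r.
have wcvg x i : cvgn (fun k => w k x 0 i).
  have [Ex|nEx] := pselect (E x); last first.
    rewrite (_ : (fun k => _) = cst 0); first exact: is_cvg_cst.
    by apply/funext => k; rewrite /w indicE memNset// scale0r mxE.
  pose C := Num.sqrt (fine (G x)).
  apply: (@summable_increments_cvg _ C); first exact: sqrtr_ge0.
  move=> k; rewrite /w indicE mem_set// !scale1r.
  have Gx : 8 ^+ k.+1 * dot (D k x) (D k x) <= fine (G x).
    rewrite -lee_fin fineK ?ge0_fin_numE//.
    have := @nneseries_lim_ge _ (fun k => (8 ^+ k.+1 * dot (D k x) (D k x))%:E)
      xpredT 0 k.+1 (fun n _ _ => _).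
    move=> /(_ (fun n => _)) h; apply: le_trans (h _); last first.
      by move=> j; rewrite lee_fin.
    by rewrite big_nat_recr//= leeDr// sume_ge0// => j _; rewrite lee_fin.
  rewrite -(@ler_pXn2r _ 2) ?nnegrE ?mulr_ge0 ?sqrtr_ge0//.
  rewrite exprMn sqr_sqrtr ?fine_ge0// real_normK ?num_real//.
  have h1 : (v k.+1 x 0 i - v k x 0 i) ^+ 2 <= dot (D k x) (D k x).
    rewrite /dot /= /row_dot (bigD1 i)//= !mxE -expr2 lerDl.
    by apply: sumr_ge0 => j _; rewrite -expr2 sqr_ge0.
  apply: le_trans h1 _.
  have h8 : 0 < 8 ^+ k.+1 :> R by rewrite exprn_gt0.
  rewrite -(ler_pM2l h8); apply: le_trans Gx _.
  rewrite mulrCA ler_peMr ?fine_ge0//.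
  rewrite -exprM mulnC exprM -exprMn exprn_ege1//; lra.
pose g x : 'rV[R]_m := \row_i limn (fun k => w k x 0 i).
have wg x i : (fun k => w k x 0 i) @ \oo --> g x 0 i by rewrite mxE; exact: wcvg.
have mg : coord_measurable g.
  by move=> i; apply: measurable_fun_cvg (fun k => mw k i) _ => x _; exact: wg.
(* Fatou's lemma in j transfers the Cauchy bound to the pointwise limit. *)
have gw k : (\int[mu]_x (dot (g x - w k x) (g x - w k x))%:E <= (e k ^+ 2)%:E)%E.
  pose f j x := (dot (w (j + k)%N x - w k x) (w (j + k)%N x - w k x))%:E.
  have mf j : measurable_fun setT (f j).
    by apply/measurable_EFinP; apply: coord_measurable_dot; exact: coord_measurableB.
  have f0 j x : [set: T] x -> (0 <= f j x)%E by rewrite lee_fin dot_ge0.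
  have := fatou mu measurableT mf f0.
  have -> : (fun x => limn_einf (f^~ x)) =
      (fun x => (dot (g x - w k x) (g x - w k x))%:E).
    apply/funext => x; apply: (cvg_limn_einf_sup _).1.
    apply: cvg_EFin; first exact: nearW.
    rewrite /comp /=; apply: coord_cvg_dot => i.
    by have := wg x i; rewrite -(cvg_shiftn k).
  move=> /le_trans; apply.
  have intf j : (\int[mu]_x f j x <= (e k ^+ 2)%:E)%E.
    have h : ae_eq mu setT (v (j + k)%N - v k : L2 mu m)
        (fun x => w (j + k)%N x - w k x).
      have h1 := L2_funB (v (j + k)%N) (v k).
      apply: filterS3 (wv (j + k)%N) (wv k) h1 => x /(_ I) h1 /(_ I) h2 /(_ I) h3 _.
      by rewrite h1 h2 h3.
    rewrite -(L2_norm_ae _ h) ?lee_fin; last exact: coord_measurableB.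
    by rewrite ler_pXn2r ?nnegrE ?(ltW (e0 k)).
  rewrite limn_einf_lim; apply: lime_le; first exact: is_cvg_einfs.
  apply: nearW => j; apply: le_trans (intf j).
  by apply: ereal_inf_lbound; exists j => /=.
have [H HE] : exists H : L2 mu m, ae_eq mu setT H (fun x => g x - w 0%N x).
  apply: L2_lift; first exact: coord_measurableB.
  exact: le_lt_trans (gw 0%N) (ltry _).
pose F : L2 mu m := H + v 0%N.
have Fg : ae_eq mu setT F g.
  have h1 := L2_funD H (v 0%N).
  apply: filterS3 h1 HE (wv 0%N) => x /(_ I) h1 /(_ I) h2 /(_ I) h3 _.
  by rewrite h1 h2 h3 subrK.
have Fv k : `|F - v k| <= e k.
  rewrite -(@ler_pXn2r _ 2) ?nnegrE ?(ltW (e0 k))// -lee_fin.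
  have h : ae_eq mu setT (F - v k : L2 mu m) (fun x => g x - w k x).
    have h1 := L2_funB F (v k).
    apply: filterS3 h1 Fg (wv k) => x /(_ I) h1 /(_ I) h2 /(_ I) h3 _.
    by rewrite h1 h2 h3.
  by rewrite (L2_norm_ae _ h)//; exact: coord_measurableB.
exists F; apply: cvgn_dist => eps eps0.
have eps2 : 0 < eps / 2 by rewrite divr_gt0.
have [k _ hk] := near_harmonic_lt eps2.
have ek : e k <= eps / 2.
  apply: le_trans (ltW (hk k (leqnn k))); rewrite /e exprVn.
  by rewrite lef_pV2 ?posrE ?exprn_gt0// -natrX ler_nat ltnW// ltn_expl.
exists (N k) => i Ni.
have := ler_distD (v k) (u i) F; have := vk k i Ni; have := Fv k.
by rewrite (distrC F); lra.
Qed.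

End L2_complete.

(** * Measurability and comparison of extended real integrals *)

Lemma lsc_row_measurable (R : realType) (m : nat) (f : 'rV[R]_m -> \bar R) :
  lower_semicontinuous f -> measurable_fun [set: 'rV[R]_m] f.
Proof.
move=> fl; apply: (measurability _ (ErealGenOInfty.measurableE R)).
move=> /= _ [_ [a ->]] <-; apply: measurableI => //; apply: open_measurable_row.
by rewrite preimage_itvoy; move/lower_semicontinuousP : fl; exact.
Qed.

Lemma continuous_row_measurable (R : realType) (m : nat) (h : 'rV[R]_m -> R) :
  continuous h -> measurable_fun [set: 'rV[R]_m] h.
Proof.
move=> hc; apply/measurable_EFinP; apply: lsc_row_measurable => x a.
rewrite /= lte_fin => ax; exists [set y | a < h y].
  exact: (cvgr_gt (h x) (hc x)).
by move=> y /=; rewrite lte_fin.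
Qed.

Section integrals.
Context d (T : measurableType d) (R : realType).
Variable mu : {measure set T -> \bar R}.

Lemma ae_le_integral (h1 h2 : T -> \bar R) :
  measurable_fun setT h1 -> measurable_fun setT h2 ->
  {ae mu, forall x, (h1 x <= h2 x)%E} ->
  (\int[mu]_x h1 x <= \int[mu]_x h2 x)%E.
Proof.
move=> m1 m2 h12; rewrite integralE [leRHS]integralE; apply: leeB.
  apply: ae_ge0_le_integral => //; try exact: measurable_funepos.
  by apply: filterS h12 => x h _; rewrite !unlock /= ge_max !le_max h lexx orbT.
apply: ae_ge0_le_integral => //; try exact: measurable_funeneg.
by apply: filterS h12 => x h _; rewrite !unlock /= ge_max !le_max leeN2 h lexx orbT.
Qed.

(** The convention +oo - oo = -oo makes a finite difference force both parts to be finite. *)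
Lemma integrable_fin_int (h : T -> \bar R) : measurable_fun setT h ->
  (\int[mu]_x h x)%E \is a fin_num -> mu.-integrable setT h.
Proof.
move=> mh; rewrite integralE => hf; apply/integrableP; split => //.
have p0 : (0 <= \int[mu]_x (h^\+ x))%E by exact: integral_ge0.
have n0 : (0 <= \int[mu]_x (h^\- x))%E by exact: integral_ge0.
have -> : (\int[mu]_x `|h x| = \int[mu]_x (h^\+ x) + \int[mu]_x (h^\- x))%E.
  rewrite -ge0_integralD//; first last.
  - exact: measurable_funeneg.
  - exact: measurable_funepos.
  by apply: eq_integral => x _; have := congr1 (fun g => g x) (fune_abse h).
move: hf p0 n0; case: (\int[mu]_x (h^\+ x))%E => [a||] //;
  case: (\int[mu]_x (h^\- x))%E => [b||] // _ _ _.
by rewrite -EFinD ltry.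
Qed.

End integrals.

Section measurable_comp.
Context d (T : measurableType d) (R : realType) (m : nat).
Implicit Types g : T -> 'rV[R]_m.

Lemma measurable_lsc_comp (f : 'rV[R]_m -> \bar R) g :
  lower_semicontinuous f -> coord_measurable g ->
  measurable_fun setT (fun x => f (g x)).
Proof.
move=> fl mg; apply: (measurableT_comp (f := f)); first exact: lsc_row_measurable.
exact: measurable_fun_row.
Qed.

Lemma coord_measurable_comp (p : 'rV[R]_m -> 'rV[R]_m) g :
  continuous p -> coord_measurable g -> coord_measurable (fun x => p (g x)).
Proof.
move=> pc mg i; apply: (measurableT_comp (f := fun y => p y 0 i)).
  apply: continuous_row_measurable => y.
  by apply: (cvg_comp p (fun M : 'rV[R]_m => M 0 i) (pc y)); exact: coord_continuous.
exact: measurable_fun_row.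
Qed.

End measurable_comp.

(** * The resolvent of an integral functional *)

Section L2_resolvent.
Context d (T : measurableType d) (R : realType).
Variables (mu : {measure set T -> \bar R}) (m : nat).
Variables (f : 'rV[R]_m -> \bar R) (gamma : R).
Hypothesis fproper : proper_fun f.
Hypothesis fconvex : econvex f.
Hypothesis flsc : lower_semicontinuous f.
Hypothesis gamma0 : 0 <= gamma.
Local Notation F := (@integral_functional R d T mu m f).
Local Notation Fg := (regularized F gamma).
Local Notation P := (prox f (1 + gamma)).
Hypothesis Fproper : proper_fun F.
Hypothesis sfin : sigma_finite setT mu.

Let a1 : 1 <= 1 + gamma. Proof. by rewrite lerDl. Qed.

Lemma integrand_measurable (v : L2 mu m) : measurable_fun setT (fun x => f (v x)).
Proof. by apply: measurable_lsc_comp => //; exact: L2_coord_measurable. Qed.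

Lemma integrand_integrable (v : L2 mu m) : F v \is a fin_num ->
  mu.-integrable setT (fun x => f (v x)).
Proof. by move=> Fv; apply: integrable_fin_int => //; exact: integrand_measurable. Qed.

Lemma regularized_fin (v : L2 mu m) : (Fg v \is a fin_num) = (F v \is a fin_num).
Proof. by rewrite /regularized /quadratic; case: (F v). Qed.

Lemma coord_measurable_prox (s : T -> 'rV[R]_m) : coord_measurable s ->
  coord_measurable (fun x => P (s x)).
Proof. by apply: coord_measurable_comp; exact: prox_continuous. Qed.

Section base_point.
Variables (vhat etahat : L2 mu m).
Hypothesis base : subdiff Fg vhat etahat.

Let delta x := P (vhat x + etahat x) - vhat x.

Let mdelta : coord_measurable delta.
Proof.
have mv := L2_coord_measurable vhat; have me := L2_coord_measurable etahat.
apply: coord_measurableB => //; apply: coord_measurable_prox.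
exact: coord_measurableD.
Qed.

(* The subgradient inequality tested against a competitor that replaces vhat by
   the pointwise proximal point on E only. *)
Lemma localized_increment (E : set T) : measurable E ->
  (\int[mu]_x (dot (\1_E x *: delta x) (\1_E x *: delta x))%:E < +oo)%E ->
  ae_eq mu setT (fun x => \1_E x *: delta x) (cst 0).
Proof.
move=> mE Eoo; set e := fun x => \1_E x *: delta x.
have me : coord_measurable e by apply: coord_measurableZ.
have mv := L2_coord_measurable vhat; have mh := L2_coord_measurable etahat.
have [De DeE] := L2_lift me Eoo.
pose W : L2 mu m := vhat + De.
have WE : ae_eq mu setT W (fun x => vhat x + e x).
  have h1 := L2_funD vhat De.
  by apply: filterS2 h1 DeE => x /(_ I) h1 /(_ I) h2 _; rewrite h1 h2.
(* On E the point vhat + e is the proximal point and c is a subgradient of [f] there; off E the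
   increment e vanishes. *)
pose c x := etahat x - gamma *: vhat x - (1 + gamma) *: e x.
have mc : coord_measurable c.
  apply: coord_measurableB; last by apply: (coord_measurableZ (h := cst (1 + gamma))).
  by apply: coord_measurableB => //; apply: (coord_measurableZ (h := cst gamma)).
pose C : L2 mu m := etahat - gamma *: vhat - (1 + gamma) *: De.
have CE : ae_eq mu setT C c.
  have h1 := L2_funB (etahat - gamma *: vhat) ((1 + gamma) *: De).
  have h2 := L2_funB etahat (gamma *: vhat).
  have h3 := L2_funZ gamma vhat; have h4 := L2_funZ (1 + gamma) De.
  have H := aeI (aeI h1 h2) (aeI (aeI h3 h4) DeE).
  apply: filterS H => x [[/(_ I) e1 /(_ I) e2] [[/(_ I) e3 /(_ I) e4] /(_ I) e5]] _.
  by rewrite e1 e2 e3 e4 e5.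
have [ig dg] := L2_dot_ae mc me CE DeE.
have [Fgv sub] := base.
have Fv : F vhat \is a fin_num by rewrite -regularized_fin.
have iv := integrand_integrable Fv.
have pointwise : {ae mu, forall x, (f (W x) <= f (vhat x) + (dot (c x) (e x))%:E)%E}.
  apply: filterS WE => x /(_ I) ->; rewrite /e.
  have [Ex|nEx] := pselect (E x); last first.
    by rewrite /e indicE memNset// scale0r addr0 dot0r adde0.
  rewrite /c /e indicE mem_set// scale1r /delta subrKC.
  set s := vhat x + etahat x.
  have [fp /(_ (vhat x))] := proxP fproper fconvex flsc a1 s.
  have -> : etahat x - gamma *: vhat x - (1 + gamma) *: (P s - vhat x) =
      s - (1 + gamma) *: P s by rewrite /s; dot_ring.
  have -> : dot (s - (1 + gamma) *: P s) (vhat x - P s) =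
      - dot (s - (1 + gamma) *: P s) (P s - vhat x).
    by rewrite -dotNr opprB.
  by rewrite -leeBlDr// -EFinN.
have FW : (F W <= F vhat + (dot C De)%:E)%E.
  rewrite dg -integralD//; apply: ae_le_integral => //.
    exact: integrand_measurable.
  by apply: emeasurable_funD; [exact: integrand_measurable|exact: measurable_int ig].
(* Adding this subgradient inequality to [FW] leaves (1 + gamma / 2) |De|^2 <= 0. *)
have := sub W.
have -> : W - vhat = De by rewrite /W; dot_ring.
rewrite /regularized /quadratic.
have := Fproper.1 W.
move: Fv FW; case: (F vhat) => [r||] // _; case: (F W) => [w||] //.
rewrite -!EFinD !lee_fin => FW _.
rewrite !normr_sqr_dot /W /C !(dotBl, dotDl, dotDr, dotZl, dotZr) (dotC De) => h.
have De0 : dot De De <= 0.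
  have := mulr_ge0 gamma0 (dot_ge0 De).
  rewrite /C !(dotBl, dotZl) in FW; lra.
have D0 : De = 0 by apply/dot_eq0/eqP; rewrite eq_le De0 dot_ge0.
rewrite D0 in DeE.
exact: ae_eq_trans (ae_eq_sym DeE) (L2_fun0 _ _).
Qed.

(** Square integrability of delta is not known beforehand, so it is truncated to sets of finite
    measure on which it is bounded; by sigma-finiteness these exhaust T. *)
Lemma prox_base : ae_eq mu setT (fun x => P (vhat x + etahat x)) vhat.
Proof.
have [S [TS Sinc Sfin]] := iffLR (sigma_finiteP _ _) sfin.
pose E n := S n `&` [set x | dot (delta x) (delta x) <= n%:R].
have mE n : measurable (E n).
  apply: measurableI; first exact: (Sfin n).1.
  have h : measurable_fun setT (fun x => (dot (delta x) (delta x))%:E).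
    by apply/measurable_EFinP; exact: coord_measurable_dot.
  have := emeasurable_fun_infty_c measurableT h n%:R%:E; rewrite setTI.
  by congr measurable; apply/seteqP; split => x /=; rewrite lee_fin.
have intE n : (\int[mu]_x (dot (\1_(E n) x *: delta x) (\1_(E n) x *: delta x))%:E
    < +oo)%E.
  apply: (@le_lt_trans _ _ (\int[mu]_x (n%:R%:E * (\1_(S n) x)%:E))%E).
    apply: ge0_le_integral => //.
    - by move=> x _; rewrite lee_fin dot_ge0.
    - apply/measurable_EFinP; apply: coord_measurable_dot; exact: coord_measurableZ.
    - apply: emeasurable_funM => //; apply/measurable_EFinP.
      by apply: measurable_indic; exact: (Sfin n).1.
    move=> x _; rewrite dotZl dotZr lee_fin !indicE.
    have [Ex|nEx] := boolP (x \in E n); last by rewrite !mul0r mulr_ge0.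
    move: Ex; rewrite inE => -[Sx dx].
    by rewrite mem_set// !mul1r mulr1.
  have mi : measurable_fun setT (fun x => (\1_(S n) x)%:E : \bar R).
    by apply/measurable_EFinP; apply: measurable_indic; exact: (Sfin n).1.
  have i0 x : [set: T] x -> (0 <= (\1_(S n) x)%:E :> \bar R)%E by rewrite lee_fin.
  have n0 : (0 <= n%:R%:E :> \bar R)%E by rewrite lee_fin.
  rewrite (ge0_integralZl mu measurableT mi i0 n0) integral_indic//; last first.
    exact: (Sfin n).1.
  by rewrite setIT lte_mul_pinfty//; exact: (Sfin n).2.
have ae0 n : {ae mu, forall x, \1_(E n) x *: delta x = 0}.
  by apply: filterS (localized_increment (mE n) (intE n)) => x /(_ I).
apply: filterS (ae_foralln ae0) => x hx _.
apply/eqP; rewrite -subr_eq0; apply/eqP; rewrite -/(delta x).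
have [k _ Sk] : (\bigcup_i S i) x by rewrite -TS.
pose N := (Num.trunc (dot (delta x) (delta x))).+1; pose n := maxn k N.
have := hx n; rewrite indicE mem_set ?scale1r//; split.
  by have /subsetPset := Sinc _ _ (leq_maxl k N); apply.
rewrite /=; apply: (@le_trans _ _ N%:R).
  by apply/ltW/truncnS_gt.
by rewrite ler_nat leq_maxr.
Qed.

(** Only the increment of P from the base point is visibly square integrable, by nonexpansiveness;
    the value at the base point is vhat. *)
Lemma L2_prox_exists (s : L2 mu m) :
  exists p : L2 mu m, ae_eq mu setT p (fun x => P (s x)).
Proof.
pose s0 : L2 mu m := vhat + etahat.
have ms := L2_coord_measurable s; have ms0 := L2_coord_measurable s0.
have mP : coord_measurable (fun x => P (s x) - P (s0 x)).
  by apply: coord_measurableB; exact: coord_measurable_prox.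
have [|D DE] := L2_lift (mu := mu) mP.
  have := L2_norm_ae _ (L2_funB s s0) => /(_ (coord_measurableB ms ms0)) h.
  apply: le_lt_trans (_ : (`|s - s0| ^+ 2)%:E < +oo)%E; last exact: ltry.
  rewrite h; apply: ge0_le_integral => //.
  - by move=> x _; rewrite lee_fin dot_ge0.
  - by apply/measurable_EFinP; exact: coord_measurable_dot.
  - by apply/measurable_EFinP; apply: coord_measurable_dot; exact: coord_measurableB.
  by move=> x _; rewrite lee_fin; exact: prox_dot_lip.
exists (vhat + D).
have h1 := L2_funD vhat D; have h2 := L2_funD vhat etahat.
have H := aeI (aeI h1 h2) (aeI DE prox_base).
apply: filterS H => x [[/(_ I) e1 /(_ I) e2] [/(_ I) e3 /(_ I) e4]] _.
by rewrite e1 e3 e2 e4 subrKC.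
Qed.

End base_point.

Section resolvent.
Variable L2_prox : L2 mu m -> L2 mu m.
Hypothesis L2_proxE : forall s, ae_eq mu setT (L2_prox s) (fun x => P (s x)).
Variable v0 : L2 mu m.
Hypothesis Fv0 : F v0 \is a fin_num.

Lemma L2_prox_subdiff s : subdiff Fg (L2_prox s) (s - L2_prox s).
Proof.
set p := L2_prox s.
have mp := L2_coord_measurable p.
pose c : L2 mu m := s - (1 + gamma) *: p.
have cE : ae_eq mu setT c (fun x => s x - (1 + gamma) *: p x).
  have h1 := L2_funB s ((1 + gamma) *: p); have h2 := L2_funZ (1 + gamma) p.
  by apply: filterS2 h1 h2 => x /(_ I) e1 /(_ I) e2 _; rewrite e1 e2.
have mc := L2_coord_measurable c.
have sub W : {ae mu, forall x,
    (f (p x) + (dot (c x) (W x - p x))%:E <= f (W x))%E}.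
  apply: filterS2 cE (L2_proxE s) => x /(_ I) -> /(_ I) ->.
  by have [_] := proxP fproper fconvex flsc a1 (s x); apply.
have intc : forall W : L2 mu m,
    mu.-integrable setT (fun x => (dot (c x) (W x - p x))%:E) /\
    (dot c (W - p))%:E = (\int[mu]_x (dot (c x) (W x - p x))%:E)%E.
  move=> W; apply: L2_dot_ae => //.
  - by apply: coord_measurableB => //; exact: L2_coord_measurable.
  - exact: ae_eq_refl.
  - exact: L2_funB.
have Fsub : forall W : L2 mu m, F W \is a fin_num -> F p \is a fin_num ->
    (F p + (dot c (W - p))%:E <= F W)%E.
  move=> v Fv Fp; have [ig ->] := intc v; rewrite -integralD//; last first.
    exact: integrand_integrable.
  apply: ae_le_integral => //; last exact: integrand_measurable.
  by apply: emeasurable_funD; [exact: integrand_measurable|exact: measurable_int ig].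
(* The pointwise inequality tested with v0 bounds F p from above; properness excludes -oo. *)
have Fp : F p \is a fin_num.
  have [ig _] := intc v0.
  have : (F p <= \int[mu]_x (f (v0 x) - (dot (c x) (v0 x - p x))%:E))%E.
    apply: ae_le_integral; first exact: integrand_measurable.
      by apply: emeasurable_funB; [exact: integrand_measurable|exact: measurable_int ig].
    by apply: filterS (sub v0) => x; rewrite leeBrDr.
  rewrite integralB//; last exact: integrand_integrable.
  have [_ <-] := intc v0; have := Fproper.1 p; move: Fv0.
  rewrite /integral_functional; case: (\int[mu]_x f (v0 x))%E => [r||] // _.
  by case: (\int[mu]_x f (p x))%E.
split; first by rewrite regularized_fin.
move=> W; have [FWoo|FWfin] := eqVneq (F W) +oo%E.
  by rewrite {2}/regularized FWoo addye// leey.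
have FW : F W \is a fin_num.
  by have := Fproper.1 W; move: FWfin; case: (F W).
have := Fsub W FW Fp; rewrite /regularized /quadratic.
move: Fp FW; case: (F p) => [r||] // _; case: (F W) => [w||] // _.
rewrite -!EFinD !lee_fin !normr_sqr_dot /c => h.
have := mulr_ge0 gamma0 (dot_ge0 (W - p)).
rewrite !(dotBl, dotBr, dotZl) in h *; rewrite (dotC W p); lra.
Qed.

(** By monotonicity, two points of the graph with the same sum v + eta coincide. *)
Lemma L2_prox_graph v eta : subdiff Fg v eta <-> v = L2_prox (v + eta).
Proof.
split=> [ve|vE]; last first.
  by have := L2_prox_subdiff (v + eta); rewrite -vE addrAC subrr add0r.
have := subdiff_monotone ve (L2_prox_subdiff (v + eta)).
set p := L2_prox _.
have -> : eta - (v + eta - p) = - (v - p) by dot_ring.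
rewrite dotNl oppr_ge0 => h.
apply/eqP; rewrite -subr_eq0; apply/eqP/dot_eq0/eqP.
by rewrite eq_le h dot_ge0.
Qed.

Lemma L2_prox_coco s t :
  (1 + gamma) * `|L2_prox s - L2_prox t| ^+ 2 <= dot (s - t) (L2_prox s - L2_prox t).
Proof.
have ms := L2_coord_measurable s; have mt := L2_coord_measurable t.
have mP : coord_measurable (fun x => P (s x) - P (t x)).
  by apply: coord_measurableB; exact: coord_measurable_prox.
have Ps : ae_eq mu setT (L2_prox s - L2_prox t : L2 mu m) (fun x => P (s x) - P (t x)).
  have H := aeI (L2_funB (L2_prox s) (L2_prox t)) (aeI (L2_proxE s) (L2_proxE t)).
  by apply: filterS H => x [/(_ I) e1 [/(_ I) e2 /(_ I) e3]] _; rewrite e1 e2 e3.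
have [i1 d1] := L2_dot_ae mP mP Ps Ps.
have [i2 d2] := L2_dot_ae (coord_measurableB ms mt) mP (L2_funB s t) Ps.
rewrite normr_sqr_dot -lee_fin EFinM d1 d2 -integralZl//.
apply: le_integral => //; first exact: integrableZl.
by move=> x _; rewrite -EFinM lee_fin; exact: prox_monotone.
Qed.

Hypothesis fproto : proto_differentiable (subdiff f).

(** Dominated convergence: the quotients converge pointwise and, like their limit, are bounded by |h
    x|, so the squared error is at most 4 |h x|^2. The limit is measurable as a pointwise limit of
    measurable functions. *)
Lemma L2_prox_dir_deriv (s h : L2 mu m) : exists z, dir_deriv L2_prox s h z.
Proof.
have ms := L2_coord_measurable s; have mh := L2_coord_measurable h.
have [D DP] := choice (fun x =>
  prox_dir_deriv fproper fconvex flsc a1 fproto (s x) (h x)).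
pose Q (k : nat) x := k.+1%:R *: (P (s x + k.+1%:R^-1 *: h x) - P (s x)).
have QD x : (fun k => Q k x) @ \oo --> D x by exact: DP.
have msh (k : nat) : coord_measurable (fun x => s x + k.+1%:R^-1 *: h x).
  by apply: coord_measurableD => //; apply: (coord_measurableZ (h := cst _)).
have mQ k : coord_measurable (Q k).
  apply: (coord_measurableZ (h := cst k.+1%:R)) => //.
  by apply: coord_measurableB; exact: coord_measurable_prox.
have QDi x i : (fun k => Q k x 0 i) @ \oo --> D x 0 i.
  apply: (cvg_comp (Q^~ x) (fun M : 'rV[R]_m => M 0 i) (QD x)).
  exact: coord_continuous.
have mD : coord_measurable D.
  by move=> i; apply: measurable_fun_cvg (fun k => mQ k i) _ => x _; exact: QDi.
have Qh k x : dot (Q k x) (Q k x) <= dot (h x) (h x).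
  by rewrite -ler_sqrt ?dot_ge0//; exact: quotient_dot_le.
have Dh x : dot (D x) (D x) <= dot (h x) (h x).
  apply: (cvgn_le_cst (u := fun k => dot (Q k x) (Q k x))).
    by apply: row_cvg_dot; exact: QD.
  by apply: nearW => k; exact: Qh.
have mhh : measurable_fun setT (fun x => (dot (h x) (h x))%:E).
  by apply/measurable_EFinP; exact: coord_measurable_dot.
have ih : mu.-integrable setT (fun x => (dot (h x) (h x))%:E).
  exact: L2_dot_integrable.
have [|Z ZD] := L2_lift (mu := mu) mD.
  apply: le_lt_trans (_ : (`|h| ^+ 2)%:E < +oo)%E; last exact: ltry.
  rewrite L2_norm_int; apply: ge0_le_integral => //.
  - by move=> x _; rewrite lee_fin dot_ge0.
  - by apply/measurable_EFinP; exact: coord_measurable_dot.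
  - by move=> x _; rewrite lee_fin.
exists Z.
pose q (k : nat) : L2 mu m := k.+1%:R *: (L2_prox (s + k.+1%:R^-1 *: h) - L2_prox s).
have mQD k : coord_measurable (fun x => Q k x - D x) by exact: coord_measurableB.
have qE k : ae_eq mu setT (q k - Z : L2 mu m) (fun x => Q k x - D x).
  have h1 := L2_funB (q k) Z.
  have h2 := L2_funZ k.+1%:R (L2_prox (s + k.+1%:R^-1 *: h) - L2_prox s).
  have h3 := L2_funB (L2_prox (s + k.+1%:R^-1 *: h)) (L2_prox s).
  have h4 := L2_proxE (s + k.+1%:R^-1 *: h); have h5 := L2_proxE s.
  have h6 := L2_funD s (k.+1%:R^-1 *: h); have h7 := L2_funZ k.+1%:R^-1 h.
  have H := aeI (aeI (aeI h1 h2) (aeI h3 h4)) (aeI (aeI h5 h6) (aeI h7 ZD)).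
  apply: filterS H => x [[[/(_ I) e1 /(_ I) e2] [/(_ I) e3 /(_ I) e4]]
    [[/(_ I) e5 /(_ I) e6] [/(_ I) e7 /(_ I) e8]]] _.
  by rewrite e1 e2 e3 e4 e5 e6 e7 e8.
have nE k : (`|q k - Z| ^+ 2)%:E =
    (\int[mu]_x (dot (Q k x - D x) (Q k x - D x))%:E)%E by exact: L2_norm_ae.
have lim0 : (fun k => (\int[mu]_x (dot (Q k x - D x) (Q k x - D x))%:E)%E)
    @ \oo --> 0%E.
  pose fk (k : nat) x := (dot (Q k x - D x) (Q k x - D x))%:E.
  have mfk k : measurable_fun setT (fk k).
    by apply/measurable_EFinP; exact: coord_measurable_dot.
  have cfk : {ae mu, forall x, setT x ->
      (fun k => fk k x) @ \oo --> (cst 0%E : T -> \bar R) x}.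
    apply: aeW => x _; apply: cvg_EFin; first exact: nearW.
    rewrite /comp /= -(dot0r (D x - D x)) -[X in dot _ X](subrr (D x)).
    exact: coord_cvg_dot.
  have ig : mu.-integrable setT (fun x => 4%:E * (dot (h x) (h x))%:E)%E.
    exact: integrableZl.
  have bfk : {ae mu, forall x k, setT x ->
      (`|fk k x| <= 4%:E * (dot (h x) (h x))%:E)%E}.
    apply: aeW => x k _; rewrite /fk gee0_abs; last by rewrite lee_fin dot_ge0.
    rewrite -EFinM lee_fin.
    have := Qh k x; have := Dh x; have := dot_ge0 (Q k x + D x).
    rewrite !(dotBl, dotBr, dotDl, dotDr) (dotC (D x)); lra.
  have [_ _] := dominated_convergence measurableT mfk (measurable_cst _) cfk ig bfk.
  by rewrite integral0.
apply: cvgn_dist => e e0.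
have e20 : (0 < (e ^+ 2)%:E)%E by rewrite lte_fin exprn_gt0.
have lim1 : (fun k => `|q k - Z| ^+ 2) @ \oo --> (0 : R).
  have lim2 : (fun k => (`|q k - Z| ^+ 2)%:E) @ \oo --> (0 : R)%:E.
    by under eq_fun do rewrite nE.
  exact: fine_cvg lim2.
have e2 : 0 < e ^+ 2 by rewrite exprn_gt0.
have [N _ HN] := cvgr_lt 0 lim1 (e ^+ 2) e2.
by exists N => i /HN /ltW; rewrite ler_pXn2r ?nnegrE ?(ltW e0).
Qed.

End resolvent.
End L2_resolvent.

(** * The equivalence for the saddle map on L2 *)

Lemma continuous_linear_le (R : realType) (V W : normedModType R)
    (A : {linear V -> W}) : continuous A ->
  exists2 b : R, 0 < b & forall x, `|A x| <= b * `|x|.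
Proof.
move=> /linear_bounded_continuous/linear_boundedP[M [_ hM]].
exists (Num.max (M + 1) 1); first by rewrite lt_max ltr01 orbT.
by apply: hM; rewrite lt_max ltrDl ltr01.
Qed.

Lemma sigma_finite_lebesgue_on (R : realType) (n : nat) (Omega : set 'rV[R]_n)
  (oO : open Omega) : sigma_finite setT (lebesgue_on oO).
Proof.
have [F TF Foo] := sigma_finiteT (lebesgue_row R n); exists F => // i.
have [mF Fi] := Foo i; split => //; apply: le_lt_trans Fi.
apply: le_measure; rewrite ?inE//.
by apply: measurableI => //; exact: open_measurable_row.
Qed.

Theorem proposition4p8 (R : realType) (n mX mY : nat)
    (Omega : set 'rV[R]_n) (oOmega : open Omega) (dOmega : domain Omega)
    (alpha gamma : R)
    (K : L2_on oOmega mX -> L2_on oOmega mY)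
    (fstar : 'rV[R]_mY -> \bar R)
    (V : L2_on oOmega mY -> L2_on oOmega mY -> set (L2_on oOmega mY))
    (uhat : L2_on oOmega mX) (vhat : L2_on oOmega mY) :
  let G := fun u : L2_on oOmega mX => quadratic alpha u in
  let Fstar := integral_functional (mu := lebesgue_on oOmega) fstar in
  let Fgamma := regularized Fstar gamma in
  let H := saddle_map G Fgamma K in
  0 < alpha -> 0 <= gamma ->
  C1 K ->
  proper_fun fstar -> econvex fstar -> lower_semicontinuous fstar ->
  proto_differentiable (subdiff fstar) ->
  proper_fun Fstar ->
  (forall v eta, subdiff Fgamma v eta ->
    cone (V v eta) /\
    forall dv,
      (V v eta dv ->
        conv_graph_deriv (subdiff Fgamma) v eta dv =
          [set gamma *: dv + z | z in polar (V v eta)]) /\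
      (~ V v eta dv ->
        conv_graph_deriv (subdiff Fgamma) v eta dv = set0)) ->
  H uhat (uhat, vhat) 0 ->
  aubin (inverse (H uhat)) 0 (uhat, vhat) <->
  (0 < gamma \/ (0 < bbar alpha Fgamma K V uhat vhat)%E).
Proof.
move=> G Fstar Fgamma H alpha0 gamma0 [Kd _] fp fc fl fproto Fp HV Hhat.
pose X := L2_on oOmega mX; pose Y := L2_on oOmega mY.
have Xc : seq_complete X by exact: L2_seq_complete.
have Yc : seq_complete Y by exact: L2_seq_complete.
have [nA nA0 A_le] := continuous_linear_le (diff_continuous (Kd uhat)).
have [As adjE adj] := adjoint_exists Xc A_le.
pose c := K uhat - 'd K uhat uhat.
have HE : H uhat = saddle_rel (subdiff Fgamma) alpha ('d K uhat) As c.
  exact: saddle_map_rel.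
rewrite HE in Hhat *.
have [_ /= base] := Hhat.
have KE : 'd K uhat uhat + c = K uhat by rewrite /c subrKC.
have sfin := sigma_finite_lebesgue_on oOmega.
have [P PE] := choice (L2_prox_exists fp fc fl gamma0 Fp sfin base).
have Fv : Fstar vhat \is a fin_num by have := base.1; rewrite regularized_fin.
have coco := L2_prox_coco fp fc fl gamma0 PE.
have SP := L2_prox_graph fp fc fl gamma0 Fp PE Fv.
have PD := L2_prox_dir_deriv fp fc fl gamma0 PE fproto.
have VS v eta : subdiff Fgamma v eta -> forall dv,
  (V v eta dv -> conv_graph_deriv (subdiff Fgamma) v eta dv =
    [set gamma *: dv + z | z in polar (V v eta)]) /\
  (~ V v eta dv -> conv_graph_deriv (subdiff Fgamma) v eta dv = set0).
  by move=> /HV[].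
split.
  move=> aub; have [g0|g0] := eqVneq gamma 0; last by left; rewrite lt_neqAle eq_sym g0.
  right.
  have [kap [t [kap0 t0 coer]]] :=
    aubin_coercive gamma0 coco SP PD VS alpha0 nA0 A_le adj g0 aub.
  apply: (coercive_bbar adjE kap0 t0) => v eta Sv vt et.
  by have := coer v eta Sv vt; rewrite KE g0; exact.
move=> gb.
have [kap [t [kap0 t0 coer]]] : exists kap t : R, [/\ 0 < kap, 0 < t &
    forall v eta, subdiff Fgamma v eta -> `|v - vhat| < t -> `|eta - K uhat| < t ->
    coercive_on gamma (schur alpha ('d K uhat) As) kap (V v eta)].
  have [g0|g0] := eqVneq gamma 0; last first.
    have gp : 0 < gamma by rewrite lt_neqAle eq_sym g0.
    (* For gamma > 0 the regularization alone is coercive, because B is nonnegative. *)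
    exists gamma, 1; split => // v eta _ _ _ z _.
    by rewrite lerDr dot_schur_ge0.
  case: gb => [|bb]; first by rewrite g0 ltxx.
  rewrite g0; apply: (bbar_coercive alpha0 adjE adj nA0 A_le _ bb) => v eta _ z _.
  by rewrite dot0l.
(* The radius is halved because eta = s - P s may vary twice as much as s. *)
apply: (coercive_aubin gamma0 coco SP PD VS alpha0 nA0 A_le adj kap0 _ Yc Hhat
  (t := t / 2)).
  by rewrite divr_gt0.
have Pv : P (vhat + ('d K uhat uhat + c)) = vhat.
  by have /esym := iffLR (SP _ _) base; rewrite add0r.
move=> s st; have lip := resolvent_lip gamma0 coco s (vhat + ('d K uhat uhat + c)).
rewrite Pv in lip; apply: coer.
- exact: graph_resolvent SP s.
- by lra.
- rewrite -KE.
  have -> : s - P s - ('d K uhat uhat + c) =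
    (s - (vhat + ('d K uhat uhat + c))) - (P s - vhat) by dot_ring.
  have := ler_normB (s - (vhat + ('d K uhat uhat + c))) (P s - vhat); lra.
Qed.
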